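(* For a dimension $d\in\mathbb{N}$: 1) $\mathcal{P}_d^{\mathrm{U}}=\mathcal{P}_d$ for $d\le 9$, that is, the set of correlation matrices of $d$-dimensional random vectors with standard uniform margins coincides with the set of all $d\times d$ correlation matrices for $d\le 9$. For $d\ge 10$, $\mathcal{P}_d^{\mathrm{U}}\subseteq\mathcal{P}_d$. 2) $\mathcal{S}_d=\mathcal{P}_d^{\mathrm{U}}$, that is, the set of $d\times d$ Spearman's rho matrices coincides with the set of correlation matrices of $d$-dimensional random vectors with standard uniform margins. 3) $\mathcal{B}_d=\mathcal{P}_d^{\mathrm{B}}(1/2)$, that is, the set of $d\times d$ Blomqvist's beta matrices coincides with the set of correlation matrices of $d$-dimensional random vectors with symmetric Bernoulli margins. 4) $\mathcal{W}_d=\mathcal{P}_d$, that is, the set of $d\times d$ matrices of van der Waerden's coefficients coincides with the set of all $d\times d$ correlation matrices.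
   Context: For a distribution function $G$ with quantile function $G^{-1}(p)=\inf\{x\in\mathbb{R}:G(x)\ge p\}$, $p\in(0,1)$, and a random vector $(X_1,X_2)$ with continuous margins $F_1,F_2$, let $\kappa_G(X_1,X_2)=\rho(G^{-1}(F_1(X_1)),G^{-1}(F_2(X_2)))$, where $\rho$ is Pearson's correlation coefficient. Spearman's rho $\rho_{\mathrm S}$, Blomqvist's beta $\beta$ and van der Waerden's coefficient $\zeta$ are $\kappa_G$ for $G$ the distribution function of $\mathrm{U}(0,1)$, of $\mathrm{Bern}(1/2)$, and of the standard normal distribution $\mathrm{N}(0,1)$, respectively (so $\beta=4C(1/2,1/2)-1$ for $C$ the copula of $(X_1,X_2)$). $\mathcal{S}_d$, $\mathcal{B}_d$, $\mathcal{W}_d$ denote the sets of all $d\times d$ matrices $(\kappa(X_i,X_j))_{i,j}$, where $(X_1,\dots,X_d)$ ranges over random vectors with continuous margins and $\kappa=\rho_{\mathrm S},\beta,\zeta$, respectively. $\mathcal{P}_d$ is the set of all $d\times d$ correlation matrices, that is, of all symmetric positive semi-definite matrices in $[-1,1]^{d\times d}$ with unit diagonal. $\mathcal{P}_d^{\mathrm{U}}$ and $\mathcal{P}_d^{\mathrm{B}}(1/2)$ are the sets of correlation matrices of $d$-dimensional random vectors all of whose margins are $\mathrm{U}(0,1)$ and $\mathrm{Bern}(1/2)$, respectively. *)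

(* Defs.v *)
From HB Require Import structures.
From mathcomp Require Import all_boot all_order all_algebra.
From mathcomp Require Import all_classical all_reals all_analysis.

Set Implicit Arguments.
Unset Strict Implicit.
Unset Printing Implicit Defensive.

Import Order.TTheory GRing.Theory Num.Theory.
Import numFieldNormedType.Exports.

Local Open Scope classical_set_scope.
Local Open Scope ring_scope.

(* Pearson's correlation coefficient. It has its usual meaning when X and Y
   are square-integrable with positive variances, which is the case in all the
   uses below; if a variance is zero, the value is 0. *)
Definition pearson (disp : measure_display) (T : measurableType disp)
    (R : realType) (P : probability T R) (X Y : T -> R) : R :=
  fine (covariance P X Y) /
  (Num.sqrt (fine 'V_P[X]) * Num.sqrt (fine 'V_P[Y])).

Definition dfun (R : realType) (mu : probability (measurableTypeR R) R)
    (x : R) : R :=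
  fine (mu `]-oo, x]%classic).

Definition rcdf (disp : measure_display) (T : measurableType disp)
    (R : realType) (P : probability T R) (X : {RV P >-> R}) (x : R) : R :=
  fine (cdf X x).

(* The quantile function is meant for 0 < p < 1. At other points [inf] may
   take its default value 0 (on sets that are empty or unbounded below), but
   when the distribution function F of X is continuous, F(X) lies in (0, 1)
   almost surely, so [kappa] does not depend on these values. *)
Definition quantile (R : realType) (G : R -> R) (p : R) : R :=
  inf [set x | p <= G x].

Definition kappa (disp : measure_display) (T : measurableType disp)
    (R : realType) (P : probability T R) (G : R -> R)
    (X1 X2 : {RV P >-> R}) : R :=
  pearson P (fun t => quantile G (rcdf X1 (X1 t)))
            (fun t => quantile G (rcdf X2 (X2 t))).

Definition uniform01 (R : realType) : probability (measurableTypeR R) R :=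
  uniform_prob (@ltr01 R).

Definition natr_of_bool (R : realType) (b : bool) : measurableTypeR R :=
  b%:R.

Lemma measurable_natr_of_bool (R : realType) :
  measurable_fun [set: bool] (@natr_of_bool R).
Proof. by []. Qed.

HB.instance Definition _ (R : realType) :=
  isMeasurableFun.Build _ _ _ _ (@natr_of_bool R) (@measurable_natr_of_bool R).

(* [bernoulli_prob] is a law on bool; this is its image in R. *)
Definition bernoulli_half (R : realType) : probability (measurableTypeR R) R :=
  distribution (bernoulli_prob (2^-1 : R)) (@natr_of_bool R).

Definition std_normal (R : realType) : probability (measurableTypeR R) R :=
  normal_prob 0 1.

Definition spearman_rho (disp : measure_display) (T : measurableType disp)
    (R : realType) (P : probability T R) (X1 X2 : {RV P >-> R}) : R :=
  kappa (dfun (uniform01 R)) X1 X2.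

Definition blomqvist_beta (disp : measure_display) (T : measurableType disp)
    (R : realType) (P : probability T R) (X1 X2 : {RV P >-> R}) : R :=
  kappa (dfun (bernoulli_half R)) X1 X2.

Definition van_der_waerden (disp : measure_display) (T : measurableType disp)
    (R : realType) (P : probability T R) (X1 X2 : {RV P >-> R}) : R :=
  kappa (dfun (std_normal R)) X1 X2.

Definition continuous_margins (disp : measure_display)
    (T : measurableType disp) (R : realType) (P : probability T R) (d : nat)
    (X : 'I_d -> {RV P >-> R}) : Prop :=
  forall i, continuous (rcdf (X i)).

Definition spearman_matrices (R : realType) (d : nat) : set 'M[R]_d :=
  [set A | exists (disp : measure_display) (T : measurableType disp)
             (P : probability T R) (X : 'I_d -> {RV P >-> R}),
      continuous_margins X /\ A = \matrix_(i, j) spearman_rho (X i) (X j)].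

Definition blomqvist_matrices (R : realType) (d : nat) : set 'M[R]_d :=
  [set A | exists (disp : measure_display) (T : measurableType disp)
             (P : probability T R) (X : 'I_d -> {RV P >-> R}),
      continuous_margins X /\ A = \matrix_(i, j) blomqvist_beta (X i) (X j)].

Definition van_der_waerden_matrices (R : realType) (d : nat) : set 'M[R]_d :=
  [set A | exists (disp : measure_display) (T : measurableType disp)
             (P : probability T R) (X : 'I_d -> {RV P >-> R}),
      continuous_margins X /\ A = \matrix_(i, j) van_der_waerden (X i) (X j)].

Definition correlation_matrices (R : realType) (d : nat) : set 'M[R]_d :=
  [set A | [/\ A^T = A,
               forall x : 'cV[R]_d, 0 <= (x^T *m A *m x) 0 0,
               forall i j, -1 <= A i j <= 1 &
               forall i, A i i = 1]].

(* Correlation matrices of random vectors all of whose margins have law mu. *)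
Definition correlation_matrices_of (R : realType)
    (mu : probability (measurableTypeR R) R) (d : nat) : set 'M[R]_d :=
  [set A | exists (disp : measure_display) (T : measurableType disp)
             (P : probability T R) (X : 'I_d -> {RV P >-> R}),
      (forall i (B : set R), measurable B -> distribution P (X i) B = mu B) /\
      A = \matrix_(i, j) pearson P (X i) (X j)].

Arguments spearman_matrices : clear implicits.
Arguments blomqvist_matrices : clear implicits.
Arguments van_der_waerden_matrices : clear implicits.
Arguments correlation_matrices : clear implicits.
Arguments correlation_matrices_of : clear implicits.
Arguments correlation_matrices_of {R} mu d _.

(* Main.v *)
Require Import Defs.
From HB Require Import structures.
From mathcomp Require Import all_boot all_order all_algebra.
From mathcomp Require Import all_classical all_reals all_analysis.
From mathcomp Require Import measurable_realfun ring lra.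

(** Let mu be a law on R with a finite second moment and a positive variance. The
    set of correlation matrices of vectors with all margins mu consists of
    correlation matrices, since these are rescaled covariance matrices
    ([correlation_matrices_of_sub]), and it is convex: a mixture of two vectors
    with margins mu has margins mu, and, the means and variances being fixed, the
    correlations mix linearly ([correlation_matrices_of_convex]).

    Uniform margins. If U is uniform on the unit sphere of R^3, every projection
    v . U with |v| = 1 is uniform on [-1, 1] (Archimedes), so the Gram matrix of d
    unit vectors v_1, ..., v_d of R^3 is the correlation matrix of the uniform
    variables 1/2 + (v_i . U) / 2 ([sphere_uniform], [gram_correlation_matrix]).
    For d <= 9 every correlation matrix is a convex combination of such Gram
    matrices ([gram_rank3_convex]). Indeed, let A = V V^T where V has r >= 4
    columns. The quadratic forms in four variables have dimension 10 > d, so some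
    S <> 0 vanishes on all rows of V; then V (I + t S) V^T has unit diagonal for
    all t, and moving t both ways until I + t S becomes singular expresses A by
    Gram matrices of vectors in smaller dimension.

    Coefficients kappa. If X has a continuous distribution function F, then F(X)
    is uniform and the quantile transform of X has law mu, so the matrices of
    coefficients kappa are correlation matrices of vectors with margins mu
    ([kappa_matrix_law]). Conversely, the quantile function of mu at F(X) equals a
    given variable Y of law mu almost surely as soon as it is at most Y, because
    both have the same law ([same_law_le_ae]). If the distribution function of mu
    is continuous this applies with X = Y ([correlation_matrix_kappa]), which
    covers the uniform and the normal law. For the Bernoulli law it applies with
    X = Y + V, where V is uniform and independent of Y
    ([correlation_matrix_blomqvist]).

    Normal margins. A correlation matrix A = V V^T is the correlation matrix of
    V Z for a standard Gaussian vector Z ([gaussian_vector]).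

    The invariance of the Gaussian law and of the uniform law on the ball under
    rotations both come from the identity
    int int h(a x + b y, x^2 + y^2) dx dy = int int h(x, x^2 + y^2) dx dy, for
    a^2 + b^2 = 1 ([integral_rotation2]). *)

Set Implicit Arguments.
Unset Strict Implicit.
Unset Printing Implicit Defensive.

Import Order.TTheory GRing.Theory Num.Theory.
Import numFieldNormedType.Exports.

Local Open Scope classical_set_scope.
Local Open Scope ring_scope.

(** * Positive semi-definite matrices and Gram factorizations *)

(** Symmetric positive semi-definite matrices. *)
Definition psd (R : realType) (n : nat) (A : 'M[R]_n) : Prop :=
  A^T = A /\ forall x : 'cV[R]_n, 0 <= (x^T *m A *m x) 0 0.

Lemma psd_gram (R : realType) (m n : nat) (V : 'M[R]_(m, n)) : psd (V *m V^T).
Proof.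
split; first by rewrite trmx_mul trmxK.
move=> x; have -> : x^T *m (V *m V^T) *m x = (V^T *m x)^T *m (V^T *m x).
  by rewrite trmx_mul trmxK !mulmxA.
by rewrite mxE; apply: sumr_ge0 => k _; rewrite !mxE -expr2 sqr_ge0.
Qed.

Lemma psd_congr (R : realType) (m n : nat) (A : 'M[R]_n) (V : 'M[R]_(m, n)) :
  psd A -> psd (V *m A *m V^T).
Proof.
move=> [As Ap]; split; first by rewrite !trmx_mul trmxK As mulmxA.
move=> x; have := Ap (V^T *m x).
by rewrite trmx_mul trmxK !mulmxA.
Qed.

(** Cholesky factorization: the recursion is on the Schur complement of A 0 0. *)
Lemma psd_gram_factor (R : realType) (n : nat) (A : 'M[R]_n) :
  psd A -> exists V : 'M[R]_n, A = V *m V^T.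
Proof.
elim: n A => [|n IHn] A; first by exists 0; apply/matrixP => -[].
rewrite -[n.+1]/(1 + n)%N in A * => -[As Ap].
set a := A 0 0; set b : 'cV[R]_n := dlsubmx A; set C := drsubmx A.
have blk : A = block_mx a%:M b^T b C.
  rewrite -[LHS](submxK A); congr block_mx => //.
    apply/matrixP => i j; rewrite !ord1 !mxE /= mulr1n.
    by rewrite /a; congr (A _ _); apply/val_inj.
  apply/matrixP => i j; rewrite !ord1 !mxE.
  by rewrite -[in LHS]As mxE.
have Cs : C^T = C by rewrite /C trmx_drsub As.
have form (s : R) (y : 'cV[R]_n) :
    0 <= a * s ^+ 2 + 2 * s * (b^T *m y) 0 0 + (y^T *m C *m y) 0 0.
  have := Ap (col_mx s%:M y); rewrite blk tr_col_mx mul_row_block mul_row_col.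
  rewrite !mulmxDl !tr_scalar_mx !mul_mx_scalar !mul_scalar_mx scale_scalar_mx.
  have -> : y^T *m b = (b^T *m y)^T by rewrite trmx_mul trmxK.
  rewrite -scalemxAl; move: (b^T *m y) (y^T *m C *m y) => u v.
  rewrite !mxE /= !mulr1n => h; apply: le_trans h _.
  by rewrite le_eqVlt; apply/orP; left; apply/eqP; ring.
have a0 : 0 <= a.
  by have := form 1 0; rewrite !mulmx0 !mxE; lra.
have b0 : a = 0 -> b = 0.
  move=> az; apply/matrixP => i j; rewrite ord1 mxE.
  pose q := ((b^T *m b) 0 0); pose c := ((b^T *m C *m b) 0 0).
  have q0 : 0 <= q.
    by rewrite /q mxE sumr_ge0// => k _; rewrite !mxE -expr2 sqr_ge0.
  have fs s : 0 <= 2 * s * q + c.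
    by have := form s b; rewrite az mul0r add0r.
  have {fs} qz : q = 0.
    apply/eqP/negPn/negP => qn; have := fs (- (c + 1) / (2 * q)).
    have -> : 2 * (- (c + 1) / (2 * q)) * q = - (c + 1) by field.
    lra.
  move: qz; rewrite /q mxE => /eqP; rewrite psumr_eq0; last first.
    by move=> k _; rewrite !mxE -expr2 sqr_ge0.
  by move=> /allP/(_ i); rewrite mem_index_enum !mxE mulf_eq0 orbb => /(_ isT)/eqP.
have [|W CW] := IHn (C - a^-1 *: (b *m b^T)).
  split.
    by rewrite linearB linearZ /= trmx_mul trmxK Cs.
  move=> y; set u := (b^T *m y) 0 0.
  have ub : b^T *m y = u%:M by apply/matrixP => i j; rewrite !ord1 [RHS]mxE mulr1n.
  have -> : (y^T *m (C - a^-1 *: (b *m b^T)) *m y) 0 0 =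
      (y^T *m C *m y) 0 0 - a^-1 * u ^+ 2.
    rewrite mulmxBr mulmxBl -scalemxAr -scalemxAl.
    have -> : y^T *m (b *m b^T) *m y = (b^T *m y)^T *m (b^T *m y).
      by rewrite trmx_mul trmxK !mulmxA.
    rewrite ub tr_scalar_mx -scalar_mxM; move: (y^T *m C *m y) => z.
    by rewrite !mxE mulr1n expr2.
  have := form (- u / a) y; rewrite -/u.
  have [az|an] := eqVneq a 0; first by rewrite az invr0; lra.
  have -> : a * (- u / a) ^+ 2 + 2 * (- u / a) * u = - (a^-1 * u ^+ 2) by field.
  lra.
exists (block_mx (Num.sqrt a)%:M 0 ((Num.sqrt a)^-1 *: b) W).
rewrite tr_block_mx mulmx_block blk; congr block_mx.
- by rewrite tr_scalar_mx trmx0 mul0mx addr0 -scalar_mxM -expr2 sqr_sqrtr.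
- rewrite mul0mx addr0 linearZ /= mul_scalar_mx scalerA.
  have [az|an] := eqVneq a 0; first by rewrite b0// trmx0 scaler0.
  by rewrite divff ?scale1r// sqrtr_eq0 -ltNge lt_def an.
- rewrite trmx0 mulmx0 addr0 tr_scalar_mx mul_mx_scalar scalerA.
  have [az|an] := eqVneq a 0; first by rewrite b0// scaler0.
  by rewrite divff ?scale1r// sqrtr_eq0 -ltNge lt_def an.
- rewrite -CW linearZ /= -scalemxAl -scalemxAr scalerA -invfM -expr2 sqr_sqrtr//.
  by rewrite addrC subrK.
Qed.

(** A singular positive semi-definite matrix is the Gram matrix of vectors
    living in a space of smaller dimension. *)
Lemma psd_gram_factor_singular (R : realType) (n : nat) (A : 'M[R]_n) :
  psd A -> A \notin unitmx ->
  exists k (W : 'M[R]_(n, k)), (k < n)%N /\ A = W *m W^T.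
Proof.
move=> pA nA; have [V AV] := psd_gram_factor pA.
pose B := row_base V *m (row_base V)^T.
have [W BW] := psd_gram_factor (psd_gram (row_base V)).
exists (\rank V), (col_base V *m W); split.
  rewrite ltn_neqAle rank_leq_row andbT; apply: contra nA => /eqP rV.
  have Vu : V \in unitmx by rewrite -row_free_unit /row_free rV.
  by rewrite AV unitmx_mul Vu unitmx_tr Vu.
rewrite trmx_mul mulmxA -(mulmxA (col_base V)) -BW.
by rewrite mulmxA -[_ *m _ *m (col_base V)^T]mulmxA -trmx_mul mulmx_base.
Qed.

(** * Matrices of order at most 9 as mixtures of Gram matrices of points of the sphere *)

Lemma quad_formE (R : realType) n (A : 'M[R]_n) (x : 'cV_n) :
  (x^T *m A *m x) 0 0 = \sum_i \sum_j A i j * (x i 0 * x j 0).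
Proof.
rewrite mxE exchange_big /=; apply: eq_bigr => j _.
by rewrite mxE mulr_suml; apply: eq_bigr => i _; rewrite !mxE; ring.
Qed.

Lemma quad_form_add1 (R : realType) n (S : 'M[R]_n) (t : R) (x : 'cV_n) :
  (x^T *m (1%:M + t *: S) *m x) 0 0 = (x^T *m x) 0 0 + t * (x^T *m S *m x) 0 0.
Proof.
by rewrite mulmxDr mulmx1 mulmxDl -scalemxAr -scalemxAl [LHS]mxE [X in _ + X]mxE.
Qed.

Lemma sqnorm_ge0 (R : realType) n (x : 'cV[R]_n) : 0 <= (x^T *m x) 0 0.
Proof. by rewrite mxE sumr_ge0// => k _; rewrite !mxE -expr2 sqr_ge0. Qed.

(** The identity is interior to the cone of positive semi-definite matrices. *)
Lemma psd_perturb (R : realType) n (S : 'M[R]_n) : S^T = S ->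
  exists2 e : R, 0 < e & psd (1%:M + e *: S).
Proof.
move=> Ss; pose c := \sum_i \sum_j `|S i j|.
have c0 : 0 <= c by apply: sumr_ge0 => i _; apply: sumr_ge0.
exists (c + 1)^-1; first by rewrite invr_gt0 ltr_wpDl.
split; first by rewrite linearD linearZ /= tr_scalar_mx Ss.
move=> x; rewrite quad_form_add1; set N := (x^T *m x) 0 0.
have N0 : 0 <= N := sqnorm_ge0 x.
have xN i : x i 0 ^+ 2 <= N.
  rewrite /N mxE (bigD1 i)//= !mxE -expr2 lerDl sumr_ge0// => k _.
  by rewrite !mxE -expr2 sqr_ge0.
have xxN i j : `|x i 0 * x j 0| <= N.
  rewrite normrM; have := xN i; have := xN j.
  rewrite -(real_normK (num_real (x i 0))) -(real_normK (num_real (x j 0))).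
  have := sqr_ge0 (`|x i 0| - `|x j 0|).
  by nra.
have : `|(x^T *m S *m x) 0 0| <= c * N.
  rewrite quad_formE (le_trans (ler_norm_sum _ _ _))// mulr_suml ler_sum// => i _.
  rewrite (le_trans (ler_norm_sum _ _ _))// mulr_suml ler_sum// => j _.
  by rewrite normrM ler_wpM2l.
rewrite ler_norml => /andP[+ _].
set q := (x^T *m S *m x) 0 0 => hq.
have h : 0 < (c + 1)^-1 by rewrite invr_gt0 ltr_wpDl.
have : (c + 1)^-1 * (- (c * N)) <= (c + 1)^-1 * q by rewrite ler_pM2l.
have -> : (c + 1)^-1 * (- (c * N)) = - N + N * (c + 1)^-1.
  by field; rewrite gt_eqF// ltr_wpDl.
have : 0 <= N * (c + 1)^-1 by rewrite mulr_ge0// ltW.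
lra.
Qed.

(** A half-line issued from the identity in a direction S that is not positive
    semi-definite leaves the cone through a singular matrix. *)
Lemma psd_exit (R : realType) n (S : 'M[R]_n) (x0 : 'cV[R]_n) :
  S^T = S -> (x0^T *m S *m x0) 0 0 < 0 ->
  exists t : R, [/\ 0 < t, psd (1%:M + t *: S) & 1%:M + t *: S \notin unitmx].
Proof.
move=> Ss qx0.
have sym t : (1%:M + t *: S)^T = 1%:M + t *: S.
  by rewrite linearD linearZ /= tr_scalar_mx Ss.
pose E := [set t : R | 0 <= t /\ psd (1%:M + t *: S)].
have E0 : E 0.
  split=> //; rewrite scale0r addr0; split; first by rewrite tr_scalar_mx.
  by move=> x; rewrite mulmx1 sqnorm_ge0.
have Eb (x : 'cV[R]_n) : (x^T *m S *m x) 0 0 < 0 ->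
    ubound E ((x^T *m x) 0 0 / - (x^T *m S *m x) 0 0).
  move=> qx t [t0 [_ /(_ x)]]; rewrite quad_form_add1 => h.
  by rewrite ler_pdivlMr ?oppr_gt0//; lra.
have hs : has_sup E by split; [exists 0|eexists; exact: Eb qx0].
set t := sup E; exists t.
have t0 : 0 <= t by apply: ub_le_sup => //; case: hs.
have pt : psd (1%:M + t *: S).
  split=> // x; rewrite quad_form_add1.
  have [qx|qx] := leP 0 ((x^T *m S *m x) 0 0).
    by rewrite addr_ge0 ?sqnorm_ge0// mulr_ge0.
  have : t <= (x^T *m x) 0 0 / - (x^T *m S *m x) 0 0.
    by apply: ge_sup; [case: hs|exact: Eb].
  by rewrite ler_pdivlMr ?oppr_gt0//; lra.
(* If I + t S = W W^T were invertible, psd_perturb applied to the congruent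
   direction W^-1 S W^-T would contradict the maximality of t. *)
have nu : 1%:M + t *: S \notin unitmx.
  apply/negP => u; have [W hW] := psd_gram_factor pt.
  have Wu : W \in unitmx by move: u; rewrite hW unitmx_mul => /andP[].
  have [|e e0 pe] := @psd_perturb _ _ (invmx W *m S *m (invmx W)^T).
    by rewrite !trmx_mul trmxK Ss mulmxA.
  have := psd_congr W pe; rewrite mulmxDr mulmxDl mulmx1 -hW.
  rewrite -scalemxAr -scalemxAl.
  have -> : W *m (invmx W *m S *m (invmx W)^T) *m W^T = S.
    rewrite !mulmxA mulmxV// mul1mx -mulmxA -trmx_mul mulmxV//.
    by rewrite trmx1 mulmx1.
  rewrite -addrA -scalerDl => pte.
  have : t + e <= t.
    by apply: ub_le_sup; [case: hs|split => //; rewrite addr_ge0// ltW].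
  lra.
split=> //; rewrite lt_def t0 andbT; apply: contra nu => /eqP ->.
by rewrite scale0r addr0 unitmx1.
Qed.

Lemma psd_diag0 (R : realType) n (A : 'M[R]_n) :
  psd A -> (forall i, A i i = 0) -> A = 0.
Proof.
move=> pA A0; have [V AV] := psd_gram_factor pA.
suff V0 : V = 0 by rewrite AV V0 mul0mx.
apply/matrixP => i j; rewrite mxE.
have := A0 i; rewrite AV mxE => /eqP; rewrite psumr_eq0; last first.
  by move=> k _; rewrite !mxE -expr2 sqr_ge0.
by move=> /allP/(_ j); rewrite mem_index_enum !mxE mulf_eq0 orbb => /(_ isT)/eqP.
Qed.

(** Polarization. *)
Lemma quad_form0 (R : realType) n (S : 'M[R]_n) : S^T = S ->
  (forall x : 'cV_n, (x^T *m S *m x) 0 0 = 0) -> S = 0.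
Proof.
move=> Ss q0.
have ent i j : (delta_mx i 0 : 'cV[R]_n)^T *m S *m (delta_mx j 0 : 'cV[R]_n) =
    (S i j)%:M.
  rewrite trmx_delta -rowE -colE; apply/matrixP => k l.
  by rewrite !ord1 !mxE mulr1n.
apply/matrixP => i j; rewrite mxE.
have := q0 (delta_mx i 0 + delta_mx j 0).
rewrite [(_ + _)^T]linearD /= !mulmxDl !mulmxDr !ent !mxE /= !mulr1n.
have := q0 (delta_mx i 0); rewrite ent mxE mulr1n => ->.
have := q0 (delta_mx j 0); rewrite ent mxE mulr1n => ->.
have -> : S j i = S i j by rewrite -{1}Ss mxE.
lra.
Qed.

(** The quadratic forms in the first four variables form a space of dimension
    10, hence some nonzero one vanishes at any given d <= 9 points. *)
Lemma quadrics_through_points (R : realType) d r (V : 'M[R]_(d, r)) :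
  (d <= 9)%N -> (4 <= r)%N ->
  exists S : 'M[R]_r, [/\ S^T = S, S != 0 & forall i, (V *m S *m V^T) i i = 0].
Proof.
move=> d9 r4.
(* The ten pairs (i, j) with i <= j < 4 index the monomials x_i x_j. *)
pose q (k : 'I_10) : nat * nat := nth (0, 0)%N
  [:: (0,0); (0,1); (1,1); (0,2); (1,2); (2,2); (0,3); (1,3); (2,3); (3,3)]%N k.
have q4 k : [&& (q k).1 <= (q k).2, (q k).1 < 4 & (q k).2 < 4]%N.
  by case: k => -[|[|[|[|[|[|[|[|[|[|?]]]]]]]]]].
have qinj k l : q k = q l -> k = l.
  move=> h; apply/val_inj => /=; apply/eqP.
  rewrite -(@nth_uniq _ (0, 0)%N [:: (0,0); (0,1); (1,1); (0,2); (1,2); (2,2);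
     (0,3); (1,3); (2,3); (3,3)]%N) ?ltn_ord//.
  exact/eqP.
have q1 k : ((q k).1 < r)%N by have /and3P[_ h _] := q4 k; exact: leq_trans h r4.
have q2 k : ((q k).2 < r)%N by have /and3P[_ _ h] := q4 k; exact: leq_trans h r4.
pose a k := Ordinal (q1 k); pose b k := Ordinal (q2 k).
pose E k : 'M[R]_r := delta_mx (a k) (b k) + delta_mx (b k) (a k).
pose M : 'M[R]_(10, d) := \matrix_(k, i) (V *m E k *m V^T) i i.
have kn : kermx M != 0.
  rewrite -mxrank_eq0 mxrank_ker subn_eq0 -ltnNge.
  by rewrite (leq_ltn_trans (rank_leq_col _)).
have /rowV0Pn[u /sub_kermxP uM u0] := kn.
pose S := \sum_k u 0 k *: E k.
have Ss : S^T = S.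
  rewrite /S linear_sum; apply: eq_bigr => k _ /=.
  by rewrite linearZ linearD /= !trmx_delta addrC.
exists S; split=> //.
- apply: contra u0 => /eqP S0; apply/eqP/matrixP => i k; rewrite ord1 mxE.
  have : S (a k) (b k) = 0 by rewrite S0 mxE.
  rewrite /S summxE (bigD1 k)//= big1 ?addr0.
    rewrite !mxE !eqxx /=.
    have [ab|ab] := eqVneq (a k) (b k) => /=; last by rewrite addr0 mulr1.
    by move=> /eqP; rewrite mulf_eq0 -mulr2n pnatr_eq0 orbF => /eqP.
  move=> l lk; rewrite !mxE.
  have ne : q k != q l by apply: contra lk => /eqP/qinj ->.
  have -> : (a k == a l) && (b k == b l) = false.
    apply/negP => /andP[/eqP[h1] /eqP[h2]]; move/eqP: ne; apply.
    by rewrite [q k]surjective_pairing [q l]surjective_pairing h1 h2.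
  have -> : (a k == b l) && (b k == a l) = false.
    apply/negP => /andP[/eqP[h1] /eqP[h2]]; move/eqP: ne; apply.
    have /and3P[hk _ _] := q4 k; have /and3P[hl _ _] := q4 l.
    rewrite [q k]surjective_pairing [q l]surjective_pairing.
    have e1 : (q k).1 = (q k).2.
      by apply/eqP; rewrite eqn_leq hk h1 h2 hl.
    by rewrite -h1 -h2 e1.
  by rewrite /= addr0 mulr0.
- move=> i; have /matrixP/(_ 0 i) := uM; rewrite mxE [RHS]mxE => uMi.
  rewrite /S mulmx_sumr mulmx_suml summxE -[RHS]uMi.
  by apply: eq_bigr => k _; rewrite -scalemxAr -scalemxAl [LHS]mxE [M k i]mxE.
Qed.

(** For d <= 9, a convex set K that contains the Gram matrices of all families
    of d unit vectors of R^3 contains all correlation matrices: the number r of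
    columns of V in A = V V^T can be lowered down to 3. Take S <> 0 such that
    x S x^T = 0 for all rows x of V, so that V (I + t S) V^T has unit diagonal for
    all t. If S is indefinite, I + t S and I - s S are both singular and positive
    semi-definite for some t, s > 0, and A is a convex combination of the
    corresponding matrices. If S or - S is positive semi-definite, then
    V S V^T = 0 because its diagonal is 0, and A = V (I + t S) V^T with I + t S
    singular for some t. *)
Lemma gram_rank3_convex (R : realType) d (K : set 'M[R]_d) : (d <= 9)%N ->
  (forall V : 'M[R]_(d, 3), (forall i, (V *m V^T) i i = 1) -> K (V *m V^T)) ->
  (forall A B t, 0 <= t <= 1 -> K A -> K B -> K (t *: A + (1 - t) *: B)) ->
  forall A, psd A -> (forall i, A i i = 1) -> K A.
Proof.
move=> d9 K3 Kc A /psd_gram_factor[V0 ->].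
suff main r (V : 'M[R]_(d, r)) : (forall i, (V *m V^T) i i = 1) -> K (V *m V^T).
  exact: main.
elim/ltn_ind: r V => r IH V V1.
have [r3|r4] := leqP r 3.
  (* fewer than three columns are padded with zeros *)
  pose pm : 'M[R]_(r, 3) := pid_mx r.
  have VE : V *m V^T = (V *m pm) *m (V *m pm)^T.
    rewrite trmx_mul tr_pid_mx mulmxA -(mulmxA V) mul_pid_mx.
    by rewrite minnn (minn_idPr r3) pid_mx_1 mulmx1.
  by rewrite VE; apply: K3 => i; rewrite -VE V1.
have [S [Ss S0 VS0]] := quadrics_through_points V d9 r4.
have step (T : 'M[R]_r) (x : 'cV_r) : T^T = T -> (forall i, (V *m T *m V^T) i i = 0) ->
    (x^T *m T *m x) 0 0 < 0 ->
    exists2 t : R, 0 < t & K (V *m V^T + t *: (V *m T *m V^T)).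
  move=> Ts VT0 /(psd_exit Ts)[t [t0 pT nT]]; exists t => //.
  have [k [W [kr TW]]] := psd_gram_factor_singular pT nT.
  have VE : V *m V^T + t *: (V *m T *m V^T) = (V *m W) *m (V *m W)^T.
    rewrite trmx_mul !mulmxA -(mulmxA V W) -TW mulmxDr mulmxDl mulmx1.
    by rewrite -scalemxAr -scalemxAl.
  rewrite VE; apply: IH => // i.
  by rewrite -VE mxE V1 mxE VT0 mulr0 addr0.
have SN : (- S)^T = - S by rewrite linearN /= Ss.
have VSN0 i : (V *m (- S) *m V^T) i i = 0.
  by rewrite mulmxN mulNmx mxE VS0 oppr0.
have qN x : (x^T *m (- S) *m x) 0 0 = - (x^T *m S *m x) 0 0.
  by rewrite mulmxN mulNmx mxE.
have [[x xneg]|nneg] := pselect (exists x : 'cV_r, (x^T *m S *m x) 0 0 < 0);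
  have [[y ypos]|npos] := pselect (exists y : 'cV_r, 0 < (y^T *m S *m y) 0 0).
- have [t t0 Kt] := step S x Ss VS0 xneg.
  have [|s s0 Ks] := step (- S) y SN VSN0; first by rewrite qN oppr_lt0.
  have ts0 : t + s != 0 by rewrite gt_eqF// addr_gt0.
  have := Kc _ _ (s / (t + s)) _ Kt Ks.
  have -> : 1 - s / (t + s) = t / (t + s) by field.
  rewrite !scalerDr mulmxN mulNmx scalerN scalerN !scalerA.
  have -> : s / (t + s) * t = t / (t + s) * s by ring.
  rewrite addrACA subrr addr0 -scalerDl.
  have -> : s / (t + s) + t / (t + s) = 1 by field.
  rewrite scale1r; apply.
  by rewrite divr_ge0 ?addr_ge0 ?(ltW t0) ?(ltW s0)// ler_pdivrMr ?addr_gt0// mul1r lerDr ltW.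
- have [t t0] := step S x Ss VS0 xneg.
  have -> : V *m S *m V^T = 0; last by rewrite scaler0 addr0.
  apply/eqP; rewrite -oppr_eq0 -mulNmx -mulmxN; apply/eqP; apply: psd_diag0 => //.
  apply: psd_congr; split => // z; rewrite qN oppr_ge0 leNgt; apply/negP => hz.
  by apply: npos; exists z.
- have [|t t0] := step (- S) y SN VSN0; first by rewrite qN oppr_lt0.
  have -> : V *m (- S) *m V^T = 0; last by rewrite scaler0 addr0.
  apply/eqP; rewrite mulmxN mulNmx oppr_eq0; apply/eqP; apply: psd_diag0 => //.
  apply: psd_congr; split => // z; rewrite leNgt; apply/negP => hz.
  by apply: nneg; exists z.
- case/negP: S0; apply/eqP; apply: quad_form0 => // z; apply/eqP.
  rewrite eq_le !leNgt; apply/andP; split; apply/negP => hz.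
    by apply: npos; exists z.
  by apply: nneg; exists z.
Qed.

(** * Affine substitutions and rotations under Lebesgue measure *)

Section lebesgue_affine.
Context (R : realType) (a b : R).
Hypothesis a0 : a != 0.
Local Notation leb := (@lebesgue_measure R).
Let phi (x : measurableTypeR R) : measurableTypeR R := a * x + b.

Let mphi : measurable_fun [set: measurableTypeR R] phi.
Proof. by apply: measurable_funD => //; apply: measurable_funM. Qed.

Let k : {nonneg R} := `|a|%:nng.

Let img := pushforward leb phi.

Let img0 : img set0 = 0%E. Proof. exact: measure0. Qed.

Let img_ge0 A : (0 <= img A)%E. Proof. exact: measure_ge0. Qed.

Let img_sigma_additive : semi_sigma_additive img.
Proof. exact: measure_semi_sigma_additive. Qed.

HB.instance Definition _ := isMeasure.Build _ _ _ img
  img0 img_ge0 img_sigma_additive.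

(** Both sides agree on intervals. The right-hand side is `|a| times the measure
    of the preimage of A under x |-> a x + b. *)
Lemma lebesgue_pushforward_affine (A : set R) : measurable A ->
  leb A = mscale k img A.
Proof.
apply: (@lebesgue_measure_unique R (mscale k img)).
move=> X [[c d]/= _ <-]; rewrite /mscale/= /img /pushforward lebesgue_measure_itv/= lte_fin.
have [a_lt0|a_gt0] := ltP a 0.
  have -> : phi @^-1` `]c, d]%classic = `[(d - b) / a, (c - b) / a[%classic.
    apply/seteqP; split=> x /=; rewrite !in_itv/= /phi => /andP[h1 h2]; apply/andP.
      by split; [rewrite ler_ndivrMr// mulrC|rewrite ltr_ndivlMr// mulrC]; lra.
    by move: h1 h2; rewrite ler_ndivrMr// ltr_ndivlMr// !(mulrC x); split; lra.
  rewrite lebesgue_measure_itv/= lte_fin ltr_nM2r ?invr_lt0// ltrD2r.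
  case: ifPn => cd; last by rewrite mule0.
  by rewrite -!EFinB -EFinM /k/= ltr0_norm//; congr EFin; field.
have {}a_gt0 : 0 < a by rewrite lt_def a0.
have -> : phi @^-1` `]c, d]%classic = `](c - b) / a, (d - b) / a]%classic.
  apply/seteqP; split=> x /=; rewrite !in_itv/= /phi => /andP[h1 h2]; apply/andP.
    by split; [rewrite ltr_pdivrMr// mulrC|rewrite ler_pdivlMr// mulrC]; lra.
  by move: h1 h2; rewrite ltr_pdivrMr// ler_pdivlMr// !(mulrC x); split; lra.
rewrite lebesgue_measure_itv/= lte_fin ltr_pM2r ?invr_gt0// ltrD2r.
case: ifPn => cd; last by rewrite mule0.
by rewrite -!EFinB -EFinM /k/= gtr0_norm//; congr EFin; field.
Qed.

Lemma ge0_integral_affine (f : R -> \bar R) :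
  measurable_fun [set: R] f -> (forall x, 0 <= f x)%E ->
  (\int[leb]_x f x = `|a|%:E * \int[leb]_x f (a * x + b)%R)%E.
Proof.
move=> mf f0.
rewrite (eq_measure_integral (mscale k img)); last first.
  by move=> A mA _; exact: lebesgue_pushforward_affine.
rewrite ge0_integral_mscale//; congr (_ * _)%E.
by rewrite ge0_integral_pushforward.
Qed.

End lebesgue_affine.

Section rotation.
Context (R : realType).
Local Notation leb := (@lebesgue_measure R).
Local Open Scope ereal_scope.

(** Rotation invariance in the plane, for functions of one linear form and the
    norm only. Two one-dimensional affine substitutions suffice: for fixed x, the
    linear form a x + b y = u is taken as a variable instead of y; then, for
    fixed u, the coordinate (x - a u) / b is taken instead of x. *)
Lemma integral_rotation2 (a b : R) (h : R * R -> \bar R) :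
  (a ^+ 2 + b ^+ 2 = 1)%R ->
  measurable_fun [set: R * R] h -> (forall z, 0 <= h z) ->
  \int[leb]_x \int[leb]_y h (a * x + b * y, x ^+ 2 + y ^+ 2)%R =
  \int[leb]_x \int[leb]_y h (x, x ^+ 2 + y ^+ 2)%R.
Proof.
move=> ab1 mh h0.
have mh2 (f g : R * R -> R) : measurable_fun setT f -> measurable_fun setT g ->
    measurable_fun setT (fun z => h (f z, g z)).
  by move=> mf mg; apply: measurableT_comp => //; exact: measurable_fun_pair.
have mh1 (f g : R -> R) : measurable_fun setT f -> measurable_fun setT g ->
    measurable_fun setT (fun z => h (f z, g z)).
  by move=> mf mg; apply: measurableT_comp => //; exact: measurable_fun_pair.
have [b0|b0] := eqVneq b 0%R.
  have a1 : (a ^+ 2 = 1)%R by rewrite -ab1 b0 expr0n addr0.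
  have an0 : a != 0%R.
    by apply/eqP => a0; move: a1; rewrite a0 expr0n => /eqP; rewrite eq_sym oner_eq0.
  have an : (`|a| = 1)%R by apply/eqP; rewrite -sqrp_eq1// real_normK ?num_real// a1.
  rewrite [RHS](@ge0_integral_affine R a 0%R an0)//; last 2 first.
    - apply: (measurable_fun_fubini_tonelli_F (m2 := leb)
        (fun z : R * R => h (z.1, z.1 ^+ 2 + z.2 ^+ 2)%R)).
      + apply: mh2 => //; apply: measurable_funD; apply: measurable_funX => //.
      + by [].
    - by move=> x; apply: integral_ge0.
  rewrite an mul1e; apply: eq_integral => x _; apply: eq_integral => y _.
  by rewrite b0 mul0r addr0 exprMn a1 mul1r.
transitivity (\int[leb]_x (`|b^-1|%:E * \int[leb]_u h (u, u ^+ 2 + ((x - a * u) / b) ^+ 2)%R)).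
  apply: eq_integral => x _.
  rewrite (@ge0_integral_affine R b^-1 (- (a * x) / b)%R); last 3 first.
    - by rewrite invr_eq0.
    - apply: mh1; first by apply: measurable_funD => //; apply: measurable_funM.
      by apply: measurable_funD => //; apply: measurable_funX.
    - by [].
  congr (_ * _); apply: eq_integral => u _; congr (h (_, _)%R).
    by field.
  have sq v w : (v ^+ 2 + ((w - a * v) / b) ^+ 2 =
      (v ^+ 2 * (a ^+ 2 + b ^+ 2) + w ^+ 2 - 2 * a * v * w) / b ^+ 2)%R by field.
  have -> : (b^-1 * u + - (a * x) / b = (u - a * x) / b)%R by field.
  by rewrite !sq ab1; congr (_ / _)%R; ring.
transitivity (`|b^-1|%:E * \int[leb]_x \int[leb]_u h (u, u ^+ 2 + ((x - a * u) / b) ^+ 2)%R).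
  rewrite -ge0_integralZl//.
  - apply: (measurable_fun_fubini_tonelli_F (m2 := leb)
      (fun z : R * R => h (z.2, z.2 ^+ 2 + ((z.1 - a * z.2) / b) ^+ 2)%R)) => //.
    apply: mh2 => //; apply: measurable_funD; apply: measurable_funX => //.
    apply: measurable_funM => //; apply: measurable_funB => //.
    exact: measurable_funM.
  - by move=> x _; exact: integral_ge0.
transitivity (`|b^-1|%:E * \int[leb]_u \int[leb]_x h (u, u ^+ 2 + ((x - a * u) / b) ^+ 2)%R).
  congr (_ * _); apply: (fubini_tonelli (m1 := leb) (m2 := leb) (fun z : R * R =>
    h (z.2, z.2 ^+ 2 + ((z.1 - a * z.2) / b) ^+ 2)%R)) => //.
  apply: mh2 => //; apply: measurable_funD; apply: measurable_funX => //.
  apply: measurable_funM => //; apply: measurable_funB => //.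
  exact: measurable_funM.
rewrite -ge0_integralZl//; last 2 first.
  - apply: (measurable_fun_fubini_tonelli_G (m1 := leb)
      (fun z : R * R => h (z.2, z.2 ^+ 2 + ((z.1 - a * z.2) / b) ^+ 2)%R)) => //.
    apply: mh2 => //; apply: measurable_funD; apply: measurable_funX => //.
    apply: measurable_funM => //; apply: measurable_funB => //.
    exact: measurable_funM.
  - by move=> x _; exact: integral_ge0.
apply: eq_integral => u _.
rewrite [RHS](@ge0_integral_affine R b^-1 (- (a * u) / b)%R)//; last 2 first.
  - by rewrite invr_eq0.
  - apply: mh1 => //; apply: measurable_funD => //; exact: measurable_funX.
congr (_ * _); apply: eq_integral => x _; congr (h (_, _ + _ ^+ 2)%R).
by field.
Qed.

(** The same in space, by a rotation of the last two coordinates followed by a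
    rotation of the first two. *)
Lemma integral_rotation3 (a b c : R) (h : R * R -> \bar R) :
  (a ^+ 2 + b ^+ 2 + c ^+ 2 = 1)%R ->
  measurable_fun [set: R * R] h -> (forall z, 0 <= h z) ->
  \int[leb]_x \int[leb]_y \int[leb]_z
     h (a * x + b * y + c * z, x ^+ 2 + y ^+ 2 + z ^+ 2)%R =
  \int[leb]_x \int[leb]_y \int[leb]_z h (x, x ^+ 2 + y ^+ 2 + z ^+ 2)%R.
Proof.
move=> abc1 mh h0.
(* (b, c) = s (b', c') with (b', c') of norm 1 *)
have [s [b' [c' [s2 bE cE bc1]]]] : exists s b' c' : R,
    [/\ (s ^+ 2 = b ^+ 2 + c ^+ 2)%R, b = (s * b')%R, c = (s * c')%R &
      (b' ^+ 2 + c' ^+ 2 = 1)%R].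
  have bc0 : (0 <= b ^+ 2 + c ^+ 2)%R by rewrite addr_ge0// sqr_ge0.
  pose s := Num.sqrt (b ^+ 2 + c ^+ 2).
  have s2 : (s ^+ 2 = b ^+ 2 + c ^+ 2)%R by rewrite sqr_sqrtr.
  exists s; have [s0|s0] := eqVneq s 0%R.
    exists 1%R, 0%R; move: s2; rewrite s0 expr0n/= => /esym/eqP.
    rewrite paddr_eq0 ?sqr_ge0// !sqrf_eq0 => /andP[/eqP-> /eqP->].
    by split; rewrite ?expr0n ?expr1n /= ?mul0r ?addr0.
  exists (b / s)%R, (c / s)%R; split=> //; [by field|by field|].
  by rewrite !exprMn exprVn -mulrDl -s2 divff// expf_neq0.
have mK : measurable_fun [set: R * R] (fun p => \int[leb]_z h (p.1, p.2 + z ^+ 2)%R).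
  apply: (measurable_fun_fubini_tonelli_F (m2 := leb)
    (fun q : (R * R) * R => h (q.1.1, q.1.2 + q.2 ^+ 2)%R)) => //.
  apply: measurableT_comp => //; apply: measurable_fun_pair.
    by apply: measurableT_comp => //; exact: measurableT_comp.
  apply: measurable_funD; last exact: measurable_funX.
  exact: measurableT_comp.
transitivity (\int[leb]_x \int[leb]_y \int[leb]_z
    h (a * x + s * y, x ^+ 2 + y ^+ 2 + z ^+ 2)%R); last first.
  apply: (@integral_rotation2 a s (fun p => \int[leb]_z h (p.1, p.2 + z ^+ 2)%R)).
  - by rewrite s2 addrA.
  - exact: mK.
  - by move=> z; exact: integral_ge0.
apply: eq_integral => x _.
transitivity (\int[leb]_y \int[leb]_z
    h (a * x + s * (b' * y + c' * z), x ^+ 2 + (y ^+ 2 + z ^+ 2))%R).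
  apply: eq_integral => y _; apply: eq_integral => z _.
  by rewrite bE cE; congr (h (_, _)%R); ring.
transitivity (\int[leb]_y \int[leb]_z
    h (a * x + s * y, x ^+ 2 + (y ^+ 2 + z ^+ 2))%R).
  apply: (@integral_rotation2 b' c' (fun p => h (a * x + s * p.1, x ^+ 2 + p.2)%R)).
  - exact: bc1.
  - apply: measurableT_comp => //; apply: measurable_fun_pair.
      by apply: measurable_funD => //; exact: measurable_funM.
    exact: measurable_funD.
  - by [].
by apply: eq_integral => y _; apply: eq_integral => z _; rewrite addrA.
Qed.

End rotation.

(** * Random variables with a given law *)

Section law.
Context (disp : measure_display) (T : measurableType disp) (R : realType).
Variable P : probability T R.
Local Open Scope ereal_scope.

(** The random variable X has law mu. Here X is a bare function, its
    measurability being part of the definition. *)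
Definition has_law (X : T -> R) (mu : probability (measurableTypeR R) R) : Prop :=
  measurable_fun [set: T] X /\
  forall B : set R, measurable B -> P (X @^-1` B) = mu B.

Lemma probability_preimage_indic (X : T -> R) (B : set R) :
  measurable_fun [set: T] X -> measurable B ->
  P (X @^-1` B) = \int[P]_t (\1_B (X t))%:E.
Proof.
move=> mX mB; have mXB : measurable (X @^-1` B).
  by rewrite -[X in measurable X]setTI; exact: mX.
by rewrite -(setIT (X @^-1` B)) -integral_indic.
Qed.

Lemma has_law_ge0_integral (mu : probability (measurableTypeR R) R)
    (X : T -> R) (f : R -> \bar R) :
  has_law X mu -> measurable_fun [set: R] f -> (forall x, 0 <= f x) ->
  \int[P]_t f (X t) = \int[mu]_x f x.
Proof.
move=> [mX lX] mf f0.
pose Y : {RV P >-> measurableTypeR R} :=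
  @mfun_Sub _ _ T (measurableTypeR R) X (mem_set mX).
rewrite (eq_measure_integral (distribution P Y)); first last.
  by move=> A mA _; apply/esym; exact: lX.
exact/esym/(ge0_integral_distribution Y mf f0).
Qed.

Lemma has_law_integral (mu : probability (measurableTypeR R) R)
    (X : T -> R) (f : R -> \bar R) :
  has_law X mu -> measurable_fun [set: R] f ->
  P.-integrable [set: T] (f \o X) ->
  \int[P]_t f (X t) = \int[mu]_x f x.
Proof.
move=> [mX lX] mf intf.
pose Y : {RV P >-> measurableTypeR R} :=
  @mfun_Sub _ _ T (measurableTypeR R) X (mem_set mX).
rewrite (eq_measure_integral (distribution P Y)); first last.
  by move=> A mA _; apply/esym; exact: lX.
exact/esym/(integral_distribution (X := Y) mf intf).
Qed.

Lemma sqr_integrable_Lfun (f : T -> R) : measurable_fun [set: T] f ->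
  \int[P]_t ((f t) ^+ 2)%:E < +oo -> f \in Lfun P 2%:E.
Proof.
move=> mf f2; rewrite inE; apply/andP; split; first by rewrite inE.
rewrite inE /= /finite_norm unlock /Lnorm poweR_lty//.
rewrite (_ : (fun _ => _) = (fun t => (f t ^+ 2)%:E))//.
apply/funext => t; rewrite [LHS]poweR_EFin powR_mulrn ?normr_ge0//.
by rewrite real_normK ?num_real.
Qed.

Lemma pearson_matrix_of_law (mu : probability (measurableTypeR R) R) d
    (X : 'I_d -> T -> R) : (forall i, has_law (X i) mu) ->
  correlation_matrices_of mu d (\matrix_(i, j) pearson P (X i) (X j)).
Proof.
move=> lX; exists disp, T, P.
exists (fun i => mfun_Sub (mem_set (proj1 (lX i))) : {RV P >-> R}).
by split=> // i B mB; exact: (proj2 (lX i)).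
Qed.

Lemma RV_has_law (mu : probability (measurableTypeR R) R) (X : {RV P >-> R}) :
  (forall B : set R, measurable B -> distribution P X B = mu B) -> has_law X mu.
Proof. by move=> lX; split => //; exact: measurable_funPT. Qed.

End law.

Lemma has_law_id (R : realType) (mu : probability (measurableTypeR R) R) :
  has_law mu (fun x => x) mu.
Proof. by split; first exact: measurable_id. Qed.

(** * Covariances of square-integrable variables *)

Section covariance_L2.
Context (disp : measure_display) (T : measurableType disp) (R : realType).
Variable P : probability T R.

(** The covariance as a real number; it is meaningful for X and Y in L^2. *)
Definition cov (X Y : T -> R) : R := fine (covariance P X Y).

Lemma L2_L1 (X : T -> R) : X \in Lfun P 2%:E -> X \in Lfun P 1.
Proof. by apply: Lfun_subset12; exact: fin_num_measure. Qed.

Lemma covC (X Y : T -> R) : cov X Y = cov Y X.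
Proof. by rewrite /cov covarianceC. Qed.

Lemma cov_fin (X Y : T -> R) : X \in Lfun P 2%:E -> Y \in Lfun P 2%:E ->
  covariance P X Y \is a fin_num.
Proof.
move=> X2 Y2; apply: covariance_fin_num; [exact: L2_L1|exact: L2_L1|].
exact: Lfun2_mul_Lfun1.
Qed.

Lemma covDl (X Y Z : T -> R) : X \in Lfun P 2%:E -> Y \in Lfun P 2%:E ->
  Z \in Lfun P 2%:E -> cov (X \+ Y) Z = cov X Z + cov Y Z.
Proof.
by move=> X2 Y2 Z2; rewrite /cov covarianceDl// fineD// cov_fin.
Qed.

Lemma covZl a (X Z : T -> R) : X \in Lfun P 2%:E ->
  Z \in Lfun P 2%:E -> cov (a \o* X) Z = a * cov X Z.
Proof.
move=> X2 Z2; have XZ := Lfun2_mul_Lfun1 X2 Z2.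
by rewrite /cov (covarianceZl _ (L2_L1 X2) (L2_L1 Z2) XZ) fineM// cov_fin.
Qed.

Lemma lincomb_L2 (I : Type) (r : seq I) (x : I -> R) (X : I -> T -> R) :
  (forall i, X i \in Lfun P 2%:E) ->
  (fun t => \sum_(i <- r) x i * X i t) \in Lfun P 2%:E.
Proof.
move=> X2; elim: r => [|i r IH].
  rewrite (_ : (fun _ => _) = cst 0) ?Lfun_cst//.
  by apply/funext => t; rewrite big_nil.
rewrite (_ : (fun _ => _) = (x i \o* X i) \+ (fun t => \sum_(j <- r) x j * X j t)).
  have iX : x i \o* X i \in Lfun P 2%:E by rewrite Lfun_scale// ler1n.
  by rewrite rpredD// lee1n.
by apply/funext => t; rewrite big_cons /= mulrC.
Qed.

Lemma cov_lincombl (I : Type) (r : seq I) (x : I -> R) (X : I -> T -> R) Z :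
  (forall i, X i \in Lfun P 2%:E) -> Z \in Lfun P 2%:E ->
  cov (fun t => \sum_(i <- r) x i * X i t) Z = \sum_(i <- r) x i * cov (X i) Z.
Proof.
move=> X2 Z2; elim: r => [|i r IH].
  rewrite big_nil (_ : (fun _ => _) = cst 0) /cov ?covariance_cst_l//.
  by apply/funext => t; rewrite big_nil.
rewrite (_ : (fun _ => _) = (x i \o* X i) \+ (fun t => \sum_(j <- r) x j * X j t)).
  rewrite covDl ?lincomb_L2 ?Lfun_scale ?ler1n//.
  by rewrite IH covZl// big_cons.
by apply/funext => t; rewrite big_cons /= mulrC.
Qed.

Lemma cov_psd d (X : 'I_d -> T -> R) : (forall i, X i \in Lfun P 2%:E) ->
  psd (\matrix_(i, j) cov (X i) (X j)).
Proof.
move=> X2; split; first by apply/matrixP => i j; rewrite !mxE covC.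
move=> x; pose Z t := \sum_i x i 0 * X i t.
have Z2 : Z \in Lfun P 2%:E by exact: lincomb_L2.
suff -> : (x^T *m \matrix_(i, j) cov (X i) (X j) *m x) 0 0 = cov Z Z.
  by rewrite /cov fine_ge0// variance_ge0.
rewrite /Z cov_lincombl// !mxE; apply: eq_bigr => i _.
rewrite covC cov_lincombl// !mxE mulrC; congr (_ * _).
by apply: eq_bigr => j _; rewrite !mxE.
Qed.

Lemma pearson_cov (X Y : T -> R) (s : R) : 0 < s ->
  'V_P[X] = s%:E -> 'V_P[Y] = s%:E -> pearson P X Y = cov X Y / s.
Proof.
move=> s0 VX VY; rewrite /pearson VX VY /=.
by rewrite -expr2 sqr_sqrtr// ltW.
Qed.

(** For given equal variances, the correlation of X and Y is a function of the
    variance of X + Y. *)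
Lemma pearson_sum (X Y : T -> R) (s : R) : 0 < s ->
  X \in Lfun P 2%:E -> Y \in Lfun P 2%:E ->
  'V_P[X] = s%:E -> 'V_P[Y] = s%:E ->
  pearson P X Y = (fine 'V_P[X \+ Y] / s - 2) / 2.
Proof.
move=> s0 X2 Y2 VX VY; rewrite (pearson_cov s0)// varianceD// VX VY.
rewrite -(fineK (cov_fin X2 Y2)) /= -/(cov X Y).
by field; rewrite gt_eqF.
Qed.

End covariance_L2.

(** * Correlation matrices of vectors whose margins have the same law *)

Lemma psd_unit_diag_correlation (R : realType) d (A : 'M[R]_d) :
  psd A -> (forall i, A i i = 1) -> correlation_matrices R d A.
Proof.
move=> [As Ap] A1; split=> // i j.
have ent k l : (delta_mx k 0 : 'cV[R]_d)^T *m A *m (delta_mx l 0 : 'cV[R]_d) =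
    (A k l)%:M.
  rewrite trmx_delta -rowE -colE; apply/matrixP => a b.
  by rewrite !ord1 !mxE mulr1n.
have Aji : A j i = A i j by rewrite -{1}As mxE.
have := Ap (delta_mx i 0 + delta_mx j 0).
rewrite [(_ + _)^T]linearD /= !mulmxDl !mulmxDr !ent.
have := Ap (delta_mx i 0 - delta_mx j 0).
rewrite [(_ - _)^T]linearB /= !mulmxBl !mulmxBr !ent.
by rewrite !mxE /= !mulr1n !A1 Aji => h1 h2; apply/andP; split; lra.
Qed.

(** The laws with a finite second moment and a positive variance, for which
    the correlation coefficient of two variables of law mu makes sense. *)
Definition nondegenerate_L2 (R : realType)
    (mu : probability (measurableTypeR R) R) : Prop :=
  (\int[mu]_x (x ^+ 2)%:E < +oo)%E /\ (0 < 'V_mu[idfun : measurableTypeR R -> R])%E.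

Section moments.
Context (disp : measure_display) (T : measurableType disp) (R : realType).
Variable P : probability T R.
Variable mu : probability (measurableTypeR R) R.
Hypothesis mu2 : nondegenerate_L2 mu.
Local Open Scope ereal_scope.

Let idR : measurableTypeR R -> R := idfun.

(** The mean and the variance of mu. *)
Definition law_mean : R := fine 'E_mu[idR].
Definition law_variance : R := fine 'V_mu[idR].

Lemma idR_L2 : idR \in Lfun mu 2%:E.
Proof. by apply: sqr_integrable_Lfun; [exact: measurable_id|case: mu2]. Qed.

Lemma law_variance_gt0 : (0 < law_variance)%R.
Proof.
rewrite fine_gt0//; apply/andP; split; first by case: mu2.
by rewrite -ge0_fin_numE ?variance_ge0// variance_fin_num// idR_L2.
Qed.

Lemma has_law_L2 (X : T -> R) : has_law P X mu -> X \in Lfun P 2%:E.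
Proof.
move=> lX; apply: sqr_integrable_Lfun; first by case: lX.
rewrite (has_law_ge0_integral (f := fun x => (x ^+ 2)%:E) lX); first by case: mu2.
- by apply/measurable_EFinP; exact: measurable_funX.
- by move=> x; rewrite lee_fin sqr_ge0.
Qed.

Lemma has_law_expectation (X : T -> R) : has_law P X mu ->
  'E_P[X] = law_mean%:E.
Proof.
move=> lX; rewrite /law_mean fineK; last first.
  by rewrite expectation_fin_num// L2_L1// idR_L2.
rewrite unlock; apply: (has_law_integral (f := EFin) lX) => //.
exact/Lfun1_integrable/L2_L1/has_law_L2.
Qed.

Lemma has_law_variance (X : T -> R) : has_law P X mu ->
  'V_P[X] = law_variance%:E.
Proof.
move=> lX; rewrite /law_variance fineK ?variance_fin_num ?idR_L2//.
rewrite /variance !covariance.unlock /covariance.body (has_law_expectation lX) -/law_mean /=.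
rewrite !expectation.unlock /expectation.body.
apply: (has_law_ge0_integral
    (f := fun x => ((x - law_mean) * (x - law_mean))%:E) lX).
- by apply/measurable_EFinP; apply: measurable_funM; apply: measurable_funB.
- by move=> x; rewrite lee_fin -expr2 sqr_ge0.
Qed.

Lemma pearson_cov_law (X Y : T -> R) : has_law P X mu -> has_law P Y mu ->
  pearson P X Y = (cov P X Y / law_variance)%R.
Proof.
by move=> lX lY; apply: pearson_cov;
  [exact: law_variance_gt0|exact: has_law_variance|exact: has_law_variance].
Qed.

(** When the margins are fixed, the correlation is an affine function of the
    second moment of X + Y, which is the integral of a nonnegative function. This
    reduces the behaviour of [pearson] under almost sure equality, projections and
    mixtures to statements about such integrals. *)
Lemma pearson_moment (X Y : T -> R) : has_law P X mu -> has_law P Y mu ->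
  pearson P X Y = (((fine (\int[P]_t ((X t + Y t) ^+ 2)%:E) -
    (law_mean + law_mean) ^+ 2) / law_variance - 2) / 2)%R.
Proof.
move=> lX lY; rewrite (@pearson_sum _ _ _ P X Y law_variance) ?law_variance_gt0//;
  [|exact: has_law_L2|exact: has_law_L2|exact: has_law_variance|exact: has_law_variance].
have X2 := has_law_L2 lX; have Y2 := has_law_L2 lY.
have XY2 : (X \+ Y)%R \in Lfun P 2%:E by rewrite rpredD// lee1n.
rewrite varianceE// fineB//; last 2 first.
  - by rewrite expectation_fin_num//; exact: Lfun2_mul_Lfun1.
  - by rewrite fin_numX// expectation_fin_num// L2_L1.
congr (((_ - _) / _ - _) / _)%R; first by rewrite unlock.
by rewrite expectationD ?L2_L1// !has_law_expectation.
Qed.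

Lemma pearson_matrix_correlation d (X : 'I_d -> T -> R) : (forall i, has_law P (X i) mu) ->
  correlation_matrices R d (\matrix_(i, j) pearson P (X i) (X j)).
Proof.
move=> lX; have s0 := law_variance_gt0.
have X2 i : X i \in Lfun P 2%:E by exact: has_law_L2.
apply: psd_unit_diag_correlation; last first.
  move=> i; rewrite mxE pearson_cov_law// /cov -/(variance P (X i)).
  by rewrite has_law_variance//= divff// gt_eqF.
have -> : \matrix_(i, j) pearson P (X i) (X j) =
    law_variance^-1 *: \matrix_(i, j) cov P (X i) (X j).
  by apply/matrixP => i j; rewrite !mxE pearson_cov_law// mulrC.
have [cs cp] := cov_psd X2; split; first by rewrite linearZ /= cs.
move=> x; rewrite -scalemxAr -scalemxAl mxE mulr_ge0//.
by rewrite invr_ge0 ltW.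
Qed.

Lemma pearson_ae (X Y X' Y' : T -> R) :
  has_law P X mu -> has_law P Y mu -> has_law P X' mu -> has_law P Y' mu ->
  {ae P, forall t, X t = X' t} -> {ae P, forall t, Y t = Y' t} ->
  pearson P X Y = pearson P X' Y'.
Proof.
move=> lX lY lX' lY' aeX aeY; rewrite !pearson_moment//.
congr ((((fine _) - _) / _ - _) / _)%R; apply: ge0_ae_eq_integral => //.
- apply/measurable_EFinP; apply: measurable_funX; apply: measurable_funD.
    by case: lX.
  by case: lY.
- apply/measurable_EFinP; apply: measurable_funX; apply: measurable_funD.
    by case: lX'.
  by case: lY'.
- by move=> t _; rewrite lee_fin sqr_ge0.
- by move=> t _; rewrite lee_fin sqr_ge0.
by apply: filterS2 aeX aeY => t /= -> ->.
Qed.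

End moments.

Lemma correlation_matrices_of_sub (R : realType)
    (mu : probability (measurableTypeR R) R) d : nondegenerate_L2 mu ->
  correlation_matrices_of mu d `<=` correlation_matrices R d.
Proof.
move=> mu2 A [disp [T [P [X [lX ->]]]]].
by apply: (pearson_matrix_correlation mu2 (P := P) (X := X)) => i; exact: (RV_has_law (lX i)).
Qed.

(** * Products and mixtures of random vectors *)

Lemma integral_bernoulli_product (disp : measure_display) (T : measurableType disp)
    (R : realType) (P : probability T R) (lam : R) (f g : T -> \bar R) :
  0 <= lam <= 1 ->
  measurable_fun [set: T] f -> (forall x, 0 <= f x)%E ->
  measurable_fun [set: T] g -> (forall x, 0 <= g x)%E ->
  (\int[P \x bernoulli_prob lam]_z (if z.2 then f z.1 else g z.1) =
  lam%:E * \int[P]_x f x + (1 - lam)%:E * \int[P]_x g x)%E.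
Proof.
move=> lam01 mf f0 mg g0; have /andP[l0 l1] := lam01.
rewrite (fubini_tonelli1 (m1 := P) (m2 := bernoulli_prob lam)
  (fun z : T * bool => if z.2 then f z.1 else g z.1)); first last.
- by move=> z; case: ifP.
- by apply: measurable_fun_ifT => //; exact: measurableT_comp.
rewrite /fubini_F /=.
transitivity (\int[P]_x (lam%:E * f x + (1 - lam)%:E * g x))%E.
  apply: eq_integral => x _.
  by rewrite (integral_bernoulli_prob lam01 (f := fun b => if b then f x else g x)) //; case.
rewrite ge0_integralD//.
- by rewrite !ge0_integralZl// lee_fin subr_ge0.
- by move=> x _; rewrite mule_ge0.
- exact: measurable_funeM.
- by move=> x _; rewrite mule_ge0// lee_fin subr_ge0.
- exact: measurable_funeM.
Qed.

Section product.
Context (disp1 disp2 : measure_display) (T1 : measurableType disp1)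
  (T2 : measurableType disp2) (R : realType).
Variables (P1 : probability T1 R) (P2 : probability T2 R).
Local Open Scope ereal_scope.

Lemma integral_product_fst (f : T1 -> \bar R) :
  measurable_fun [set: T1] f -> (forall x, 0 <= f x) ->
  \int[P1 \x P2]_z f z.1 = \int[P1]_x f x.
Proof.
move=> mf f0; rewrite (fubini_tonelli1 (fun z : T1 * T2 => f z.1))//.
  apply: eq_integral => x _; rewrite /fubini_F /= integral_cst//=.
  by rewrite -[X in _ * X = _]/(P2 setT) probability_setT mule1.
by apply: measurableT_comp => //.
Qed.

Lemma integral_product_snd (f : T2 -> \bar R) :
  measurable_fun [set: T2] f -> (forall x, 0 <= f x) ->
  \int[P1 \x P2]_z f z.2 = \int[P2]_x f x.
Proof.
move=> mf f0; rewrite (fubini_tonelli2 (fun z : T1 * T2 => f z.2))//.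
  apply: eq_integral => x _; rewrite /fubini_G /= integral_cst//=.
  by rewrite -[X in _ * X = _]/(P1 setT) probability_setT mule1.
by apply: measurableT_comp => //.
Qed.

Lemma has_law_fst mu (X : T1 -> R) : has_law P1 X mu ->
  has_law (P1 \x P2) (X \o fst) mu.
Proof.
move=> [mX lX]; split; first exact: measurableT_comp.
move=> B mB; rewrite -lX//.
have mXB : measurable (X @^-1` B) by rewrite -[X in measurable X]setTI; exact: mX.
have -> : (X \o fst) @^-1` B = (X @^-1` B) `*` [set: T2].
  by apply/seteqP; split=> z //= [].
by rewrite /= product_measure1E// -[X in _ * X]/(P2 setT) probability_setT mule1.
Qed.

Lemma has_law_snd mu (X : T2 -> R) : has_law P2 X mu ->
  has_law (P1 \x P2) (X \o snd) mu.
Proof.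
move=> [mX lX]; split; first exact: measurableT_comp.
move=> B mB; rewrite -lX//.
have mXB : measurable (X @^-1` B) by rewrite -[X in measurable X]setTI; exact: mX.
have -> : (X \o snd) @^-1` B = [set: T1] `*` (X @^-1` B).
  by apply/seteqP; split=> z //= [].
by rewrite /= product_measure1E// -[X in X * _]/(P1 setT) probability_setT mul1e.
Qed.

Lemma ae_fst (Q : T1 -> Prop) :
  {ae P1, forall x, Q x} -> {ae (P1 \x P2), forall z, Q z.1}.
Proof.
move=> [N [mN N0 QN]]; exists (N `*` setT); split.
- exact: measurableX.
- apply: (etrans (product_measure1E _ _ mN measurableT)).
  by rewrite [X in X * _](_ : _ = 0) ?mul0e.
- by move=> z /= h; split=> //; exact: QN.
Qed.

Lemma ae_snd (Q : T2 -> Prop) :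
  {ae P2, forall x, Q x} -> {ae (P1 \x P2), forall z, Q z.2}.
Proof.
move=> [N [mN N0 QN]]; exists (setT `*` N); split.
- exact: measurableX.
- apply: (etrans (product_measure1E _ _ measurableT mN)).
  by rewrite [X in _ * X](_ : _ = 0) ?mule0.
- by move=> z /= h; split=> //; exact: QN.
Qed.

Lemma pearson_fst mu (X Y : T1 -> R) : nondegenerate_L2 mu ->
  has_law P1 X mu -> has_law P1 Y mu ->
  pearson (P1 \x P2) (X \o fst) (Y \o fst) = pearson P1 X Y.
Proof.
move=> mu2 lX lY; rewrite !(pearson_moment mu2)//; [|exact: has_law_fst..].
congr ((((fine _) - _) / _ - _) / _)%R.
apply: (integral_product_fst (f := fun x => ((X x + Y x) ^+ 2)%:E)).
- apply/measurable_EFinP; apply: measurable_funX; apply: measurable_funD.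
    by case: lX.
  by case: lY.
- by move=> t; rewrite lee_fin sqr_ge0.
Qed.

Variable lam : R.
Hypothesis lam01 : (0 <= lam <= 1)%R.

Local Notation Q := ((P1 \x P2) \x bernoulli_prob lam).

(** Under Q, the third coordinate is a coin of bias lam that selects a point of
    T1 or a point of T2. *)
Lemma integral_mixture (f : T1 -> \bar R) (g : T2 -> \bar R) :
  measurable_fun [set: T1] f -> (forall x, 0 <= f x) ->
  measurable_fun [set: T2] g -> (forall x, 0 <= g x) ->
  \int[Q]_z (if z.2 then f z.1.1 else g z.1.2) =
  lam%:E * \int[P1]_x f x + (1 - lam)%:E * \int[P2]_y g y.
Proof.
move=> mf f0 mg g0.
rewrite -(integral_product_fst mf f0) -(integral_product_snd mg g0).
apply: (integral_bernoulli_product (P1 \x P2) lam01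
  (f := fun z => f z.1) (g := fun z => g z.2)) => //; exact: measurableT_comp.
Qed.

Lemma has_law_mixture mu (X : T1 -> R) (Y : T2 -> R) :
  has_law P1 X mu -> has_law P2 Y mu ->
  has_law Q (fun z => if z.2 then X z.1.1 else Y z.1.2) mu.
Proof.
move=> [mX lX] [mY lY]; set W := fun z => _.
have mW : measurable_fun setT W.
  apply: measurable_fun_ifT => //.
  + by apply: measurableT_comp => //; exact: measurableT_comp.
  + by apply: measurableT_comp => //; exact: measurableT_comp.
split=> // B mB.
have mB' : measurable_fun setT (fun x : R => (\1_B x)%:E : \bar R).
  exact/measurable_EFinP/measurable_indic.
rewrite (probability_preimage_indic _ mW)//.
have -> : (fun z => (\1_B (W z))%:E : \bar R) =
    (fun z => if z.2 then (\1_B (X z.1.1))%:E else (\1_B (Y z.1.2))%:E).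
  by apply/funext => -[z []].
rewrite (integral_mixture (f := fun x => (\1_B (X x))%:E)
  (g := fun x => (\1_B (Y x))%:E) (measurableT_comp mB' mX) _
  (measurableT_comp mB' mY))//.
rewrite -(probability_preimage_indic _ mX)// -(probability_preimage_indic _ mY)//.
rewrite lX// lY// -muleDl//; last by rewrite fin_num_measure.
by rewrite -EFinD addrC subrK mul1e.
Qed.

Lemma pearson_mixture mu (X X' : T1 -> R) (Y Y' : T2 -> R) :
  nondegenerate_L2 mu ->
  has_law P1 X mu -> has_law P2 Y mu -> has_law P1 X' mu -> has_law P2 Y' mu ->
  pearson Q (fun z => if z.2 then X z.1.1 else Y z.1.2)
    (fun z => if z.2 then X' z.1.1 else Y' z.1.2) =
  (lam * pearson P1 X X' + (1 - lam) * pearson P2 Y Y')%R.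
Proof.
move=> mu2 lX lY lX' lY'.
rewrite !(pearson_moment mu2)//; [|exact: has_law_mixture..].
have sf d (T : measurableType d) (P : probability T R) (Z Z' : T -> R) :
    has_law P Z mu -> has_law P Z' mu ->
    \int[P]_x ((Z x + Z' x) ^+ 2)%:E \is a fin_num.
  move=> lZ lZ'.
  have ZZ2 : (Z \+ Z')%R \in Lfun P 2%:E.
    by have Z2 := has_law_L2 mu2 lZ; have Z2' := has_law_L2 mu2 lZ'; rewrite rpredD// lee1n.
  have /integrable_fin_num := Lfun2_integrable_sqr ZZ2; exact.
have ms d (T : measurableType d) (P : probability T R) (Z Z' : T -> R) :
    has_law P Z mu -> has_law P Z' mu ->
    measurable_fun setT (fun x => ((Z x + Z' x) ^+ 2)%:E).
  move=> [mZ _] [mZ' _].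
  by apply/measurable_EFinP; apply: measurable_funX; exact: measurable_funD.
have -> : (fun z : (T1 * T2) * bool => (((if z.2 then X z.1.1 else Y z.1.2) +
    (if z.2 then X' z.1.1 else Y' z.1.2)) ^+ 2)%:E : \bar R) =
    (fun z => if z.2 then ((X z.1.1 + X' z.1.1) ^+ 2)%:E
      else ((Y z.1.2 + Y' z.1.2) ^+ 2)%:E).
  by apply/funext => -[z []].
rewrite (integral_mixture (f := fun x => ((X x + X' x) ^+ 2)%:E)
  (g := fun x => ((Y x + Y' x) ^+ 2)%:E)).
- rewrite fineD ?fin_numM ?sf// !fineM ?sf//=.
  by field; rewrite gt_eqF// law_variance_gt0.
- exact: ms lX lX'.
- by move=> x; rewrite lee_fin sqr_ge0.
- exact: ms lY lY'.
- by move=> x; rewrite lee_fin sqr_ge0.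
Qed.

End product.

(** A mixture of two vectors with margins mu has margins mu, and its correlation
    matrix is the corresponding mixture of the correlation matrices. *)
Lemma correlation_matrices_of_convex (R : realType)
    (mu : probability (measurableTypeR R) R) d (A B : 'M[R]_d) (t : R) :
  nondegenerate_L2 mu -> 0 <= t <= 1 ->
  correlation_matrices_of mu d A -> correlation_matrices_of mu d B ->
  correlation_matrices_of mu d (t *: A + (1 - t) *: B).
Proof.
move=> mu2 t01 [d1 [T1 [P1 [X [lX ->]]]]] [d2 [T2 [P2 [Y [lY ->]]]]].
have {}lX i := RV_has_law (lX i); have {}lY i := RV_has_law (lY i).
have lW i := has_law_mixture t01 (lX i) (lY i).
have := pearson_matrix_of_law lW.
congr correlation_matrices_of.
by apply/matrixP => i j; rewrite !mxE (pearson_mixture t01 mu2).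
Qed.

(** * Comparison and identification of laws on the line *)

Section probability_facts.
Context (disp : measure_display) (T : measurableType disp) (R : realType).
Variable P : probability T R.
Local Open Scope ereal_scope.

Lemma le_prob (A B : set T) : measurable A -> measurable B ->
  A `<=` B -> P A <= P B.
Proof. by move=> mA mB AB; apply: le_measure; rewrite ?inE. Qed.

Lemma probability_mod_null (A B N : set T) :
  measurable A -> measurable B -> measurable N -> P N = 0 ->
  (forall t, ~ N t -> (A t <-> B t)) -> P A = P B.
Proof.
move=> mA mB mN PN AB.
have sub (C D : set T) : measurable C -> measurable D ->
    (forall t, ~ N t -> (C t -> D t)) -> P C <= P D.
  move=> mC mD CD; rewrite -[leRHS](measureU0 mD mN PN).
  apply: le_prob => //; first exact: measurableU.
  move=> t Ct; have [Nt|Nt] := pselect (N t); first by right.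
  by left; exact: CD.
by apply/eqP; rewrite eq_le !sub// => t Nt ?; apply/AB.
Qed.

Lemma ae_measurable_null (Q : T -> Prop) : {ae P, forall t, Q t} ->
  exists N : set T, [/\ measurable N, P N = 0 & forall t, ~ N t -> Q t].
Proof.
move=> [N [mN PN QN]]; exists N; split=> // t Nt.
by apply: contrapT => nQ; apply: Nt; exact: QN.
Qed.

(** Two variables with the same law, one below the other, coincide almost surely:
    for each rational q, the event Y <= q < X has probability 0. *)
Lemma same_law_le_ae mu (X Y : T -> R) : has_law P X mu -> has_law P Y mu ->
  {ae P, forall t, (Y t <= X t)%R} -> {ae P, forall t, Y t = X t}.
Proof.
move=> [mX lX] [mY lY] /ae_measurable_null[N [mN PN YX]].
have mray (Z : T -> R) q : measurable_fun setT Z -> measurable (Z @^-1` `]-oo, q]).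
  by move=> mZ; rewrite -[X in measurable X]setTI; exact: mZ.
pose D q := (Y @^-1` `]-oo, q]) `\` (X @^-1` `]-oo, q]).
have PD q : P (D q) = 0.
  have mXq := mray X q mX; have mYq := mray Y q mY.
  rewrite measureD//; last by rewrite ltey_eq fin_num_measure.
  rewrite [X in _ - X](_ : _ = P (X @^-1` `]-oo, q])); last first.
    apply: (probability_mod_null (N := N)) => //; first exact: measurableI.
    move=> t Nt; split=> [[]//|Xt]; split=> //.
    by move: Xt; rewrite /= !in_itv/=; apply: le_trans; exact: YX.
  transitivity (mu `]-oo, q]%classic - mu `]-oo, q]%classic).
    by congr (_ - _); [exact: lY|exact: lX].
  by rewrite subee// fin_num_measure.
have : {ae P, forall t (n : nat),
    if @unpickle rat n is Some q then ~ D (ratr q) t else True}.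
  apply: ae_foralln => n; case: unpickle => [q|]; last exact: aeW.
  exists (D (ratr q)); split; [by apply: measurableD; exact: mray|exact: PD|].
  by move=> t /= /contrapT.
have : {ae P, forall t, (Y t <= X t)%R}.
  by exists N; split=> // t /= h; apply: contrapT => Nt; apply: h; exact: YX.
apply: filterS2 => t /= YXt Dt; apply/eqP; rewrite eq_le YXt leNgt.
apply/negP => /rat_in_itvoo[q]; rewrite in_itv/= => /andP[Yq qX].
have := Dt (pickle q); rewrite pickleK; apply; split.
  by rewrite /= in_itv/= ltW.
by rewrite /= in_itv/= leNgt qX.
Qed.

End probability_facts.

Lemma eq_probability_rays (R : realType)
    (mu nu : probability (measurableTypeR R) R) :
  (forall x, mu `]-oo, x]%classic = nu `]-oo, x]%classic) ->
  forall A : set R, measurable A -> mu A = nu A.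
Proof.
move=> munu A mA.
apply: (@measure_unique _ R (measurableTypeR R) (@RGenOInfty.G R)
  (fun n => `](- n%:R), +oo[%classic)) => //.
- exact: RGenOInfty.measurableE.
- move=> _ _ [x ->] [y ->]; exists (Num.max x y).
  by apply/seteqP; split=> z /=; rewrite !in_itv/= !andbT gt_max;
    [move=> [-> ->]|move=> /andP[]].
- by move=> n; exists (- n%:R).
- rewrite -subTset => x _; exists (Num.bound x) => //=.
  by rewrite in_itv/= andbT ltrNl unstable.ltrNbound.
- move=> _ [x ->].
  have mC (m : probability (measurableTypeR R) R) :
      m `]x, +oo[%classic = (1 - m `]-oo, x]%classic)%E.
    by rewrite -setCitvl; exact: (@probability_setC _ (measurableTypeR R)).
  by apply: (etrans (mC mu)); rewrite munu -mC.
- by move=> n; rewrite ltey_eq fin_num_measure.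
Qed.

Lemma has_law_rays (disp : measure_display) (T : measurableType disp)
    (R : realType) (P : probability T R) (X : T -> R)
    (mu : probability (measurableTypeR R) R) :
  measurable_fun [set: T] X ->
  (forall x, P (X @^-1` `]-oo, x]%classic) = mu `]-oo, x]%classic) ->
  has_law P X mu.
Proof.
move=> mX lX; split=> // B mB.
pose Y : {RV P >-> measurableTypeR R} :=
  @mfun_Sub _ _ T (measurableTypeR R) X (mem_set mX).
exact: (@eq_probability_rays R (distribution P Y) mu).
Qed.

(** * Distribution functions and quantile functions *)

Section rcdf.
Context (disp : measure_display) (T : measurableType disp) (R : realType).
Variable P : probability T R.
Variable X : {RV P >-> R}.
Local Notation F := (rcdf X).

Lemma rcdfE x : (F x)%:E = P (X @^-1` `]-oo, x]%classic).
Proof. by rewrite /rcdf fineK// fin_num_measure. Qed.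

Lemma rcdf_ge0 x : 0 <= F x.
Proof. by rewrite -lee_fin rcdfE. Qed.

Lemma rcdf_le1 x : F x <= 1.
Proof. by rewrite -lee_fin /rcdf fineK ?fin_num_measure//; exact: cdf_le1. Qed.

Lemma rcdf_nd x y : x <= y -> F x <= F y.
Proof. by move=> xy; rewrite fine_le ?fin_num_measure// cdf_nondecreasing. Qed.

Lemma rcdf_top p : p < 1 -> exists x, p < F x.
Proof.
move=> p1; have /fine_cvg/cvgr_gt/(_ _ p1) := cvg_cdfy1 X.
by move/filter_ex => [x]; exists x.
Qed.

Lemma rcdf_bot p : 0 < p -> exists x, F x < p.
Proof.
move=> p0; have /fine_cvg/cvgr_lt/(_ _ p0) := cvg_cdfNy0 X.
by move/filter_ex => [x]; exists x.
Qed.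

Lemma rcdf_right x p : F x < p -> exists2 y, x < y & F y < p.
Proof.
move=> xp; have := @cdf_right_continuous _ _ _ _ X x.
rewrite -[cdf X x](rcdfE x) => /fine_cvg/cvgr_lt/(_ _ xp) h.
have h' : \forall y \near x^'+, F y < p /\ x < y.
  by apply: filterS2 h (nbhs_right_gt x) => y.
by have [y [h1 h2]] := @filter_ex _ _ (at_right_proper_filter x) _ h'; exists y.
Qed.

Lemma measurable_rcdf : measurable_fun [set: R] F.
Proof. by apply: nondecreasing_measurable => // x y; exact: rcdf_nd. Qed.

(** The Galois connection between distribution and quantile functions. *)
Lemma quantile_le p x : 0 < p < 1 -> (quantile F p <= x) = (p <= F x).
Proof.
move=> /andP[p0 p1]; rewrite /quantile; set S := [set _ | _].
have lb : has_lbound S.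
  have [x0 Fx0] := rcdf_bot p0; exists x0 => y /= py.
  by rewrite leNgt; apply/negP => /ltW/rcdf_nd; rewrite leNgt (lt_le_trans Fx0).
have S0 : S !=set0 by have [x0 /ltW] := rcdf_top p1; exists x0.
apply/idP/idP => [ix|px]; last exact: ge_inf.
rewrite leNgt; apply/negP => /rcdf_right[y xy Fy].
have : y <= inf S.
  apply: lb_le_inf => // z /= pz; rewrite leNgt; apply/negP => /ltW/rcdf_nd.
  by rewrite leNgt (lt_le_trans Fy).
by rewrite leNgt (le_lt_trans ix).
Qed.

(** The default values of the infimum outside of (0, 1]. *)
Lemma quantile_out p : p <= 0 \/ 1 < p -> quantile F p = 0.
Proof.
move=> [p0|p1]; apply: inf_out => -[].
  move=> _ [l hl]; have : l <= l - 1.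
    by apply: hl; rewrite /= (le_trans p0)// rcdf_ge0.
  by lra.
by move=> [x /=]; rewrite leNgt (le_lt_trans (rcdf_le1 x)).
Qed.

(** The quantile function is measurable on the whole line, although only its
    values on (0, 1) matter: it is 0 on ]-oo, 0] and on ]1, +oo[. *)
Lemma measurable_quantile : measurable_fun [set: R] (quantile F).
Proof.
have -> : [set: R] = `]0, 1[%classic `|` (`]-oo, 0]%classic `|` [set 1]) `|` `]1, +oo[%classic.
  apply/esym; rewrite -subTset => x _ /=.
  have [x0|x0] := leP x 0; first by left; right; left; rewrite /= in_itv.
  have [x1|x1|->] := ltgtP x 1; first by left; left; rewrite /= in_itv/= x0.
    by right; rewrite /= in_itv/= x1.
  by left; right; right.
apply/measurable_funU => //; first by apply: measurableU => //; exact: measurableU.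
split; last first.
  have h : {in `]1, +oo[%classic, cst 0 =1 quantile F}.
    by move=> x; rewrite inE/= in_itv/= andbT => x1; rewrite quantile_out//; right.
  by apply: (eq_measurable_fun _ h); exact: measurable_cst.
apply/measurable_funU => //; first exact: measurableU.
split; last first.
  apply/measurable_funU => //; split; last exact: measurable_fun_set1.
  have h : {in `]-oo, 0]%classic, cst 0 =1 quantile F}.
    by move=> x; rewrite inE/= in_itv/= => x0; rewrite quantile_out//; left.
  by apply: (eq_measurable_fun _ h); exact: measurable_cst.
apply: (measurability (@RGenOInfty.G R)).
  exact: RGenOInfty.measurableE.
move=> _ [_ [x ->] <-].
have -> : `]0, 1[%classic `&` quantile F @^-1` `]x, +oo[%classic =
    `]0, 1[%classic `&` `]F x, +oo[%classic.
  apply/seteqP; split=> p /=; rewrite !in_itv/= !andbT => -[p01 h];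
    split=> //; move: h; rewrite [x < _]ltNge [F x < _]ltNge quantile_le//.
exact: measurableI.
Qed.

End rcdf.

Section transform.
Context (disp : measure_display) (T : measurableType disp) (R : realType).
Variable P : probability T R.
Variable X : {RV P >-> R}.
Hypothesis cX : continuous (rcdf X).
Local Notation F := (rcdf X).

Let mFX : measurable_fun [set: T] (fun t => F (X t)).
Proof. by apply: measurableT_comp; [exact: measurable_rcdf|exact: measurable_funPT]. Qed.

Let mray p : measurable [set t | F (X t) <= p].
Proof.
rewrite -[X in measurable X]setTI.
have -> : [set t | F (X t) <= p] = (F \o X) @^-1` `]-oo, p]%classic.
  by apply/seteqP; split=> t /=; rewrite in_itv.
exact: mFX.
Qed.

Lemma rcdf_ivt p : 0 < p < 1 -> exists x, F x = p.
Proof.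
move=> /andP[p0 p1].
have [a Fa] := rcdf_bot X p0; have [b Fb] := rcdf_top X p1.
have ab : a <= b.
  by rewrite leNgt; apply/negP => /ltW/(rcdf_nd X); rewrite leNgt (lt_trans Fa).
have Fab := rcdf_nd X ab.
have [|c _ <-] := @IVT R F a b p ab (continuous_subspaceT cX); last by exists c.
by rewrite (min_idPl Fab) (max_idPr Fab) (ltW Fa) (ltW Fb).
Qed.

(** The probability integral transform: F(X) is uniform. *)
Lemma rcdf_uniform p : 0 <= p <= 1 -> P [set t | F (X t) <= p] = p%:E.
Proof.
have lower q : 0 < q < 1 -> (q%:E <= P [set t | (F (X t) <= q)%R])%E.
  move=> q01; have [x <-] := rcdf_ivt q01; rewrite {1}rcdfE.
  apply: le_prob => //; first exact: measurable_funPTI.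
  by move=> t /=; rewrite in_itv/=; exact: rcdf_nd.
have upper r q : r < q -> 0 < q < 1 -> (P [set t | (F (X t) <= r)%R] <= q%:E)%E.
  move=> pq q01; have [x xq] := rcdf_ivt q01; rewrite -xq rcdfE.
  apply: le_prob => //; first exact: measurable_funPTI.
  move=> t /=; rewrite in_itv/= => Ft; rewrite leNgt; apply/negP => /ltW/(rcdf_nd X).
  by rewrite xq leNgt (le_lt_trans Ft).
move=> /andP[p0 p1]; move: p1; rewrite le_eqVlt => /predU1P[->|p1].
  rewrite -(probability_setT P); congr (P _).
  by apply/seteqP; split=> t //= _; exact: rcdf_le1.
apply/eqP; rewrite eq_le; apply/andP; split.
  apply/lee_addgt0Pr => e e0; rewrite -EFinD.
  pose q := Num.min (p + e) ((p + 1) / 2).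
  have pq : p < q by rewrite lt_min ltrDl e0/=; lra.
  have q1 : q < 1 by rewrite gt_min; apply/orP; right; lra.
  apply: (le_trans (upper p q pq _)); first by rewrite q1 (le_lt_trans p0).
  by rewrite lee_fin ge_min lexx.
have [<-//|pn] := eqVneq 0 p.
by apply: lower; rewrite p1 andbT lt_def eq_sym pn.
Qed.

Lemma rcdf_in01_ae : {ae P, forall t, 0 < F (X t) < 1}.
Proof.
have h0 : {ae P, forall t, 0 < F (X t)}.
  exists [set t | F (X t) <= 0]; split => //.
    by rewrite rcdf_uniform// lexx ler01.
  by move=> t /= /negP; rewrite -leNgt.
have h1 : {ae P, forall t, F (X t) < 1}.
  have mlt : measurable [set t | F (X t) < 1].
    rewrite -[X in measurable X]setTI.
    have -> : [set t | F (X t) < 1] = (F \o X) @^-1` `]-oo, 1[%classic.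
      by apply/seteqP; split=> t /=; rewrite in_itv.
    exact: mFX.
  exists (~` [set t | F (X t) < 1]); split => //; first exact: measurableC.
  rewrite probability_setC//.
  suff -> : P [set t | F (X t) < 1] = 1%E by rewrite subee.
  apply/eqP; rewrite eq_le probability_le1//=.
  apply/lee_addgt0Pr => e e0.
  have [e1|e1] := leP 1 e.
    by apply: (@le_trans _ _ (0 + e%:E)%E); rewrite ?add0e ?lee_fin ?leeDr// leeD2r.
  have <- : ((1 - e)%:E + e%:E)%E = 1%E by rewrite -EFinD subrK.
  rewrite leeD2r// -rcdf_uniform; last by apply/andP; split; lra.
  by apply: le_prob => // t /= /le_lt_trans; apply; lra.
by apply: filterS2 h0 h1 => t /= -> ->.
Qed.

Variable mu : probability (measurableTypeR R) R.
Let idR : {RV mu >-> R} :=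
  @mfun_Sub _ _ (measurableTypeR R) R (fun x => x)
    (mem_set (@measurable_id _ (measurableTypeR R) setT)).

(** Inverse transform sampling. *)
Lemma quantile_transform_law :
  has_law P (fun t => quantile (dfun mu) (F (X t))) mu.
Proof.
have -> : dfun mu = rcdf idR by [].
have mq : measurable_fun [set: T] (fun t => quantile (rcdf idR) (F (X t))).
  by apply: (measurableT_comp (measurable_quantile idR)); exact: mFX.
apply: has_law_rays => // x.
have -> : mu `]-oo, x]%classic = (rcdf idR x)%:E by rewrite rcdfE.
rewrite -rcdf_uniform; last by rewrite rcdf_ge0 rcdf_le1.
have [N [mN PN N01]] := ae_measurable_null rcdf_in01_ae.
apply: (probability_mod_null (N := N)) => //.
  by rewrite -[X in measurable X]setTI; exact: mq.
by move=> t /N01 F01; rewrite /= in_itv/= quantile_le.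
Qed.

End transform.

(** * Quantile transforms and the coefficients kappa *)

Section lipschitz_cdf.
Context (disp : measure_display) (T : measurableType disp) (R : realType).
Variable P : probability T R.
Variable X : {RV P >-> R}.

Lemma lipschitz_rcdf_continuous (c : R) :
  (forall x y, x < y -> (P (X @^-1` `]x, y]%classic) <= (c * (y - x))%:E)%E) ->
  continuous (rcdf X).
Proof.
move=> hc.
have c0 : 0 <= c.
  by have := le_trans (measure_ge0 P _) (hc 0 1 ltr01); rewrite lee_fin subr0 mulr1.
have incr x y : x <= y -> 0 <= rcdf X y - rcdf X x <= c * (y - x).
  rewrite le_eqVlt => /predU1P[->|xy]; first by rewrite !subrr mulr0 lexx.
  apply/andP; split; first by rewrite subr_ge0 rcdf_nd// ltW.
  rewrite -lee_fin EFinB !rcdfE.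
  rewrite leeBlDr ?fin_num_measure//; last exact: measurable_funPTI.
  apply: (@le_trans _ _ (P (X @^-1` `]x, y]%classic) + P (X @^-1` `]-oo, x]%classic))%E).
    have -> : X @^-1` `]-oo, y]%classic =
        X @^-1` `]x, y]%classic `|` X @^-1` `]-oo, x]%classic.
      apply/seteqP; split=> t /=; rewrite !in_itv/=.
        by case: (leP (X t) x) => // _ ->; [right|left].
      by move=> [/andP[_ ->]//|/le_trans]; apply; exact: ltW.
    by apply: measureU2; exact: measurable_funPTI.
  by rewrite leeD2r//; exact: hc.
move=> x; apply/cvgrPdist_lt => e e0.
have d0 : 0 < e / (c + 1) by rewrite divr_gt0// ltr_wpDl.
have hd (t : R) : 0 <= t -> t < e / (c + 1) -> c * t < e.
  rewrite ltr_pdivlMr ?ltr_wpDl// => t0; apply: le_lt_trans.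
  by rewrite mulrDr mulr1 mulrC lerDl.
near=> y.
have : `|x - y| < e / (c + 1) by near: y; exact: cvgr_dist_lt.
have [xy|/ltW yx] := leP x y.
  have /andP[h1 h2] := incr _ _ xy.
  have -> : `|x - y| = y - x by rewrite distrC ger0_norm// subr_ge0.
  have -> : `|rcdf X x - rcdf X y| = rcdf X y - rcdf X x by rewrite distrC ger0_norm.
  move=> h; by apply: (le_lt_trans h2); apply: hd; rewrite // subr_ge0.
have /andP[h1 h2] := incr _ _ yx.
rewrite (ger0_norm h1) ger0_norm ?subr_ge0// => h.
by apply: (le_lt_trans h2); apply: hd; rewrite // subr_ge0.
Unshelve. all: by end_near. Qed.

End lipschitz_cdf.

Section kappa.
Context (R : realType).
Variable mu : probability (measurableTypeR R) R.

(** The quantile transforms of continuous margins have law mu. *)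
Lemma kappa_matrix_law (disp : measure_display) (T : measurableType disp)
    (P : probability T R) d (X : 'I_d -> {RV P >-> R}) :
  continuous_margins X ->
  correlation_matrices_of mu d (\matrix_(i, j) kappa (dfun mu) (X i) (X j)).
Proof.
move=> cX.
exact: (pearson_matrix_of_law (fun i => quantile_transform_law (cX i) mu)).
Qed.

(** The identity of R as a random variable of law mu. *)
Definition idRV : {RV mu >-> R} :=
  @mfun_Sub _ _ (measurableTypeR R) R (fun x => x)
    (mem_set (@measurable_id _ (measurableTypeR R) setT)).

Lemma dfun_rcdf : dfun mu = rcdf idRV. Proof. by []. Qed.

(** If Y has law mu and lies above the quantile transform of X, then both
    coincide almost surely, since they have the same law. *)
Lemma quantile_transform_ae (disp : measure_display) (T : measurableType disp)
    (P : probability T R) (X : {RV P >-> R}) (Y : T -> R) :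
  continuous (rcdf X) -> has_law P Y mu ->
  {ae P, forall t, 0 < rcdf X (X t) < 1 ->
     quantile (dfun mu) (rcdf X (X t)) <= Y t} ->
  {ae P, forall t, quantile (dfun mu) (rcdf X (X t)) = Y t}.
Proof.
move=> cX lY le; apply: (same_law_le_ae lY (quantile_transform_law cX mu)).
by apply: filterS2 le (rcdf_in01_ae cX) => t h /h.
Qed.

Lemma quantile_transform_kappa (disp : measure_display) (T : measurableType disp)
    (P : probability T R) d (X : 'I_d -> {RV P >-> R}) (Y : 'I_d -> T -> R) :
  nondegenerate_L2 mu ->
  continuous_margins X -> (forall i, has_law P (Y i) mu) ->
  (forall i, {ae P, forall t, 0 < rcdf (X i) (X i t) < 1 ->
     quantile (dfun mu) (rcdf (X i) (X i t)) <= Y i t}) ->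
  \matrix_(i, j) kappa (dfun mu) (X i) (X j) =
  \matrix_(i, j) pearson P (Y i) (Y j).
Proof.
move=> mu2 cX lY le; apply/matrixP => i j; rewrite !mxE.
apply: (pearson_ae mu2) => //; try exact: quantile_transform_law.
  exact: quantile_transform_ae.
exact: quantile_transform_ae.
Qed.

(** If mu has a continuous distribution function G, a vector X with margins mu
    realizes its own correlation matrix: the quantile of G at G(X_i) is at most
    X_i. *)
Lemma correlation_matrix_kappa d (A : 'M[R]_d) :
  nondegenerate_L2 mu -> continuous (dfun mu) ->
  correlation_matrices_of mu d A ->
  exists (disp : measure_display) (T : measurableType disp)
    (P : probability T R) (X : 'I_d -> {RV P >-> R}),
    continuous_margins X /\ A = \matrix_(i, j) kappa (dfun mu) (X i) (X j).
Proof.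
move=> mu2 cmu [disp [T [P [X [lX ->]]]]]; exists disp, T, P, X.
have FG i : rcdf (X i) = dfun mu.
  by apply/funext => x; rewrite /rcdf /dfun; congr fine; exact: lX.
have cX : continuous_margins X by move=> i; rewrite FG.
split=> //; apply/esym/quantile_transform_kappa => //.
  by move=> i; exact: (RV_has_law (lX i)).
by move=> i; apply: aeW => t; rewrite FG dfun_rcdf => h; rewrite quantile_le.
Qed.

(** A law that is not a Dirac mass has a positive variance. *)
Lemma nondegenerate_L2_no_unit_atom :
  (\int[mu]_x (x ^+ 2)%:E < +oo)%E -> (forall c : R, (mu [set c] < 1)%E) ->
  nondegenerate_L2 mu.
Proof.
move=> m2 at1; split=> //; rewrite lt_def variance_ge0 andbT; apply/eqP.
rewrite /variance covariance.unlock /covariance.body; set c := fine _.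
rewrite expectation.unlock /expectation.body => h.
have /ae_measurable_null[N [mN N0 Nc]] :
    {ae mu, forall x : measurableTypeR R, x = c}.
  have : (\int[mu]_(x in setT) `|((x - c) ^+ 2)%:E| = 0)%E.
    rewrite -[RHS]h; apply: eq_integral => x _.
    by rewrite /= ger0_norm ?sqr_ge0// expr2.
  move/ae_eq_integral_abs => /(_ measurableT)[].
    apply/measurable_EFinP; apply: measurable_funX; apply: measurable_funB => //.
  move=> M [mM M0 Mc]; exists M; split=> // x /= xc; apply: Mc => /= h'.
  apply: xc; have /eqP := h' I; rewrite eqe sqrf_eq0 subr_eq0.
  by move=> /eqP.
have : (1%:E <= mu [set c])%E.
  rewrite -(probability_setT mu) -[leRHS](measureU0 _ mN N0)//.
  apply: le_prob => //; first exact: measurableU.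
  move=> x _; have [Nx|Nx] := pselect (N x); first by right.
  by left; exact: Nc.
by rewrite leNgt at1.
Qed.

Lemma lipschitz_law (c : R) :
  (\int[mu]_x (x ^+ 2)%:E < +oo)%E ->
  (forall x y : R, x < y -> (mu `]x, y]%classic <= (c * (y - x))%:E)%E) ->
  nondegenerate_L2 mu /\ continuous (dfun mu).
Proof.
move=> m2 lip; split; last exact: (@lipschitz_rcdf_continuous _ _ _ mu idRV c).
apply: nondegenerate_L2_no_unit_atom => // x.
have c0 : 0 <= c.
  by have := le_trans (measure_ge0 mu _) (lip 0 1 ltr01); rewrite lee_fin subr0 mulr1.
have e0 : 0 < (c + 1)^-1 by rewrite invr_gt0 ltr_wpDl.
apply: (@le_lt_trans _ _ (mu `](x - (c + 1)^-1), x]%classic)).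
  apply: le_prob => // y ->; rewrite /= in_itv/= lexx andbT.
  by rewrite ltrBlDr ltrDl.
apply: (le_lt_trans (lip _ _ _)); first by rewrite ltrBlDr ltrDl.
rewrite lte_fin opprB addrCA subrr addr0 ltr_pdivrMr ?ltr_wpDl// mul1r.
by rewrite ltrDl.
Qed.

End kappa.

(** * The standard uniform law *)

Section uniform.
Context (R : realType).

Lemma uniform01E (A : set R) : measurable A ->
  uniform01 R A = lebesgue_measure (A `&` `[0, 1]%classic).
Proof.
move=> mA; rewrite /uniform01 /= /uniform_prob integral_uniform_pdf.
rewrite (eq_integral (cst 1%E)); last first.
  by move=> x; rewrite inE/= => -[_]; rewrite in_itv/= /uniform_pdf subr0 invr1 => ->.
rewrite integral_cst/= ?mul1e//; exact: measurableI.
Qed.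

Lemma uniform01_lipschitz (x y : R) : x < y ->
  (uniform01 R `]x, y]%classic <= (1 * (y - x))%:E)%E.
Proof.
move=> xy; rewrite uniform01E// mul1r.
have -> : (y - x)%:E = lebesgue_measure (`]x, y]%classic : set R).
  by rewrite lebesgue_measure_itv/= lte_fin xy EFinB.
by apply: measureIl.
Qed.

Lemma uniform01_sqr_integrable :
  (\int[uniform01 R]_x (x ^+ 2)%:E < +oo)%E.
Proof.
rewrite /uniform01 integral_uniform; last 2 first.
  - by apply/measurable_EFinP; exact: measurable_funX.
  - by move=> x; rewrite lee_fin sqr_ge0.
rewrite subr0 invr1 mul1e.
apply: (@le_lt_trans _ _ (\int[@lebesgue_measure R]_(x in `[0%R, 1%R]%classic) (cst 1%E x))%E).
  apply: ge0_le_integral => //.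
  - by move=> x _; rewrite lee_fin sqr_ge0.
  - by apply/measurable_EFinP; exact: measurable_funX.
  - move=> x /=; rewrite in_itv/= => /andP[x0 x1].
    by rewrite lee_fin expr_le1.
by rewrite integral_cst//= lebesgue_measure_itv/= lte_fin ltr01 -EFinB -EFinM ltry.
Qed.

Lemma uniform01_nondegenerate : nondegenerate_L2 (uniform01 R).
Proof.
exact: (lipschitz_law uniform01_sqr_integrable uniform01_lipschitz).1.
Qed.

Lemma uniform01_continuous : continuous (dfun (uniform01 R)).
Proof.
exact: (lipschitz_law uniform01_sqr_integrable uniform01_lipschitz).2.
Qed.

End uniform.

(** * The symmetric Bernoulli law and Blomqvist's beta *)

Section bernoulli.
Context (R : realType).

Let half01 : 0 <= (2^-1 : R) <= 1.
Proof. by apply/andP; split; lra. Qed.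

Lemma bernoulli_halfE (A : set R) :
  bernoulli_half R A = (2^-1 * (1 \in A)%:R + 2^-1 * (0 \in A)%:R)%:E.
Proof.
rewrite /bernoulli_half /= /distribution /pushforward.
rewrite bernoulli_probE// !diracE -!EFinM -EFinD; congr (_ * _%:R + _ * _%:R)%:E.
by rewrite /unstable.onem; field.
Qed.

Lemma bernoulli_half_sqr_integrable :
  (\int[bernoulli_half R]_x (x ^+ 2)%:E < +oo)%E.
Proof.
rewrite /bernoulli_half (@ge0_integral_pushforward _ _ _ _ _ (@natr_of_bool R))//.
  rewrite (integral_bernoulli_prob half01 (f := fun b => ((b%:R : R) ^+ 2)%:E)).
    by rewrite -!EFinM -EFinD ltry.
  by move=> b; rewrite lee_fin sqr_ge0.
- by apply/measurable_EFinP; exact: measurable_funX.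
- by move=> y _; rewrite lee_fin sqr_ge0.
Qed.

Lemma bernoulli_half_nondegenerate : nondegenerate_L2 (bernoulli_half R).
Proof.
apply: nondegenerate_L2_no_unit_atom; first exact: bernoulli_half_sqr_integrable.
move=> c; rewrite [X in (X < _)%E]bernoulli_halfE lte_fin.
have [->|c1] := eqVneq c 1.
  rewrite (_ : (0 \in [set 1]) = false); last first.
    by apply/negbTE; rewrite notin_setE /= => /esym/eqP; rewrite oner_eq0.
  by rewrite mulr0 addr0; case: (_ \in _) => /=; lra.
rewrite (_ : (1 \in [set c]) = false); last first.
  by apply/negbTE; rewrite notin_setE /= => h; move: c1; rewrite h eqxx.
by rewrite mulr0 add0r; case: (_ \in _) => /=; lra.
Qed.

Lemma bernoulli_half_ray (x : R) :
  bernoulli_half R `]-oo, x]%classic = (2^-1 * (1 <= x)%R%:R + 2^-1 * (0 <= x)%R%:R)%:E.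
Proof.
rewrite [LHS]bernoulli_halfE; congr (_ * _%:R + _ * _%:R)%:E.
  by rewrite mem_setE in_itv.
by rewrite mem_setE in_itv.
Qed.

Lemma dfun_bernoulli0 : dfun (bernoulli_half R) 0 = 2^-1.
Proof.
rewrite /dfun bernoulli_half_ray/= lexx.
by rewrite (_ : (1 <= 0 :> R) = false) ?mulr0 ?add0r ?mulr1// ler10.
Qed.

Lemma dfun_bernoulli1 : dfun (bernoulli_half R) 1 = 1.
Proof.
rewrite /dfun bernoulli_half_ray/= lexx ler01 mulr1; by field.
Qed.

Lemma has_law_bernoulli_01 (disp : measure_display) (T : measurableType disp)
    (P : probability T R) (B : T -> R) : has_law P B (bernoulli_half R) ->
  {ae P, forall t, B t = 0 \/ B t = 1}.
Proof.
move=> [mB lB].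
have m01 : measurable ([set 0; 1] : set R) by exact: measurableU.
exists (B @^-1` ~` [set 0; 1]); split.
- by rewrite -[X in measurable X]setTI; apply: mB => //; exact: measurableC.
- rewrite lB; last exact: measurableC.
  rewrite [LHS]bernoulli_halfE.
  rewrite (_ : (1 \in _) = false); last first.
    by apply/negbTE; rewrite notin_setE /=; apply; right.
  rewrite (_ : (0 \in _) = false); last first.
    by apply/negbTE; rewrite notin_setE /=; apply; left.
  by rewrite !mulr0 addr0.
- by move=> t /= h [|] h'; apply: h; [left|right].
Qed.

Lemma uniform01_ae : {ae uniform01 R, forall x : measurableTypeR R, 0 < x <= 1}.
Proof.
exists (~` `]0, 1]%classic); split => //.
- by apply: measurableC.
- rewrite uniform01E; last exact: measurableC.
  apply/eqP; rewrite -measure_le0 -(lebesgue_measure_set1 0).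
  apply: le_measure; rewrite ?inE//; first by apply: measurableI => //; exact: measurableC.
  move=> x /= []; rewrite !in_itv/= => h /andP[x0 x1]; apply: contrapT => xn0.
  by apply: h; rewrite x1 andbT lt_def x0 andbT; apply/eqP.
Qed.

Section smoothing.
Context (disp : measure_display) (T : measurableType disp).
Variables (P : probability T R) (B : T -> R).
Hypothesis lB : has_law P B (bernoulli_half R).

Local Notation Q := (P \x uniform01 R)%E.
Let Z (z : T * measurableTypeR R) : R := B z.1 + z.2.

Let mZ : measurable_fun [set: T * measurableTypeR R] Z.
Proof.
apply: measurable_funD; last exact: measurable_snd.
by apply: measurableT_comp => //; case: lB.
Qed.

(** The variable B + V with V uniform on (0, 1) and independent of B: its
    distribution function is continuous, and it determines B almost surely. *)
Definition smoothed : {RV Q >-> R} := mfun_Sub (mem_set mZ).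

Let lV := has_law_snd P (has_law_id (uniform01 R)).

Let aeBV : {ae Q, forall z, (B z.1 = 0 \/ B z.1 = 1) /\ 0 < (z.2 : R) <= 1}.
Proof.
apply: filterS2 (ae_fst (uniform01 R) (has_law_bernoulli_01 lB))
  (ae_snd P uniform01_ae) => z h1 h2.
by split.
Qed.

(** B + V lies in ]x, y] only if V lies in ]x, y] or in ]x - 1, y - 1], so its
    distribution function is 2-Lipschitz. *)
Lemma smoothed_continuous : continuous (rcdf smoothed).
Proof.
apply: (@lipschitz_rcdf_continuous _ _ _ _ _ 2) => x y xy.
have [N [mN N0 NQ]] := ae_measurable_null aeBV.
pose V0 := (snd : T * measurableTypeR R -> R) @^-1` `]x, y]%classic.
pose V1 := (snd : T * measurableTypeR R -> R) @^-1` `](x - 1), (y - 1)]%classic.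
have mV0 : measurable V0.
  by rewrite -[X in measurable X]setTI; apply: measurable_snd => //; exact: measurable_itv.
have mV1 : measurable V1.
  by rewrite -[X in measurable X]setTI; apply: measurable_snd => //; exact: measurable_itv.
have mZxy : measurable (smoothed @^-1` `]x, y]%classic) by exact: measurable_funPTI.
apply: (@le_trans _ _ (Q (V0 `|` V1))).
  rewrite -[leRHS](measureU0 (measurableU _ _ mV0 mV1) mN N0).
  apply: le_prob => //.
    by apply: measurableU => //; exact: measurableU.
  move=> z /= hz; have [Nz|Nz] := pselect (N z); first by right.
  left; have [[B0|B1] _] := NQ z Nz.
    by left; move: hz; rewrite /V0 /= /Z B0 add0r.
  right; move: hz; rewrite /V1 /= /Z B1 !in_itv/= => /andP[h1 h2].
  by apply/andP; split; lra.
apply: (le_trans (measureU2 _ mV0 mV1)).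
have -> : (2 * (y - x))%:E = ((1 * (y - x))%:E + (1 * (y - x))%:E)%E.
  by rewrite -EFinD; congr EFin; ring.
apply: leeD.
  apply: (@le_trans _ _ (uniform01 R `]x, y]%classic)); last exact: uniform01_lipschitz.
  by rewrite le_eqVlt; apply/orP; left; apply/eqP; apply: (lV.2).
apply: (@le_trans _ _ (uniform01 R `](x - 1), (y - 1)]%classic)).
  by rewrite le_eqVlt; apply/orP; left; apply/eqP; apply: (lV.2).
have := @uniform01_lipschitz R (x - 1) (y - 1); rewrite ltrD2r => /(_ xy).
by move=> h; apply: (le_trans h); rewrite lee_fin; lra.
Qed.

(** On B = 0 one has B + V <= 1, where the distribution function of B + V is at
    most 1/2, so that the Bernoulli quantile is 0; on B = 1 this quantile is at
    most 1. *)
Lemma smoothed_quantile : {ae Q, forall z, 0 < rcdf smoothed (smoothed z) < 1 ->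
  quantile (dfun (bernoulli_half R)) (rcdf smoothed (smoothed z)) <= (B \o fst) z}.
Proof.
have F1 : rcdf smoothed 1 <= 2^-1.
  rewrite -lee_fin rcdfE.
  have [N [mN N0 NQ]] := ae_measurable_null aeBV.
  have -> : (2^-1)%:E = bernoulli_half R [set 0].
    rewrite [RHS]bernoulli_halfE.
    rewrite (_ : (1 \in [set 0]) = false); last first.
      by apply/negbTE; rewrite notin_setE /= => /eqP; rewrite oner_eq0.
    by rewrite mem_set// mulr0 add0r mulr1.
  have [mB0 lB0] := has_law_fst (uniform01 R) lB.
  have m0 : measurable ((B \o fst : T * measurableTypeR R -> R) @^-1` [set 0]).
    by rewrite -[X in measurable X]setTI; exact: mB0.
  apply: (@le_trans _ _ (Q ((B \o fst : T * measurableTypeR R -> R) @^-1` [set 0]))); last first.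
    by rewrite le_eqVlt; apply/orP; left; apply/eqP; exact: lB0.
  rewrite -[leRHS](measureU0 m0 mN N0).
  apply: le_prob; [exact: measurable_funPTI|exact: measurableU|].
  move=> z; have [Nz|Nz] := pselect (N z); first by right.
  have [[h|h] /andP[z0 _]] := NQ z Nz; first by left.
  by rewrite /= in_itv/= /Z h => h'; exfalso; move: h' z0; lra.
have [N [mN N0 NQ]] := ae_measurable_null aeBV.
exists N; split=> // z /= hz; apply: contrapT => Nz; apply: hz => F01.
have [h /andP[z0 z1]] := NQ z Nz.
rewrite dfun_rcdf quantile_le// -dfun_rcdf /=.
case: h => h; last first.
  by rewrite h dfun_bernoulli1 rcdf_le1.
rewrite h dfun_bernoulli0; apply: le_trans F1; apply: rcdf_nd.
by rewrite /= /Z h add0r.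
Qed.

End smoothing.

(** The smoothed margins X_i + V, with a common V, have the X_i as their
    quantile transforms. *)
Lemma correlation_matrix_blomqvist d (A : 'M[R]_d) :
  correlation_matrices_of (bernoulli_half R) d A -> blomqvist_matrices R d A.
Proof.
move=> [disp [T [P [X [lX ->]]]]].
have {}lX i := RV_has_law (lX i).
exists _, (T * measurableTypeR R)%type, (P \x uniform01 R)%E.
exists (fun i => smoothed (lX i)); split.
  by move=> i; exact: smoothed_continuous.
apply/esym; rewrite /blomqvist_beta.
rewrite (quantile_transform_kappa bernoulli_half_nondegenerate
  (fun i => @smoothed_continuous _ _ P (X i) (lX i))
  (fun i => has_law_fst (uniform01 R) (lX i))
  (fun i => @smoothed_quantile _ _ P (X i) (lX i))).
by apply/matrixP => i j; rewrite !mxE (pearson_fst _ bernoulli_half_nondegenerate).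
Qed.

End bernoulli.

(** * Gaussian vectors *)

Import HBNNSimple.

Section density.
Context (disp : measure_display) (T : measurableType disp) (R : realType).
Variables (mu nu : {measure set T -> \bar R}) (f : T -> R).
Hypothesis mf : measurable_fun [set: T] f.
Hypothesis f0 : forall x, 0 <= f x.
Hypothesis nuE : forall A, measurable A -> nu A = (\int[mu]_(x in A) (f x)%:E)%E.
Local Open Scope ereal_scope.

Let integral_density_nnsfun (h : {nnsfun T >-> R}) :
  \int[nu]_x (h x)%:E = \int[mu]_x ((h x)%:E * (f x)%:E).
Proof.
under [LHS]eq_integral do rewrite fimfunE -fsumEFin//.
rewrite [LHS]ge0_integral_fsum//; last 2 first.
  - by move=> r; exact/measurable_EFinP/measurableT_comp.
  - by move=> n x _; rewrite EFinM nnfun_muleindic_ge0.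
under [RHS]eq_integral.
  move=> x _; rewrite fimfunE -fsumEFin// muleC ge0_mule_fsumr; last first.
    by move=> r; rewrite EFinM nnfun_muleindic_ge0.
  over.
rewrite [RHS]ge0_integral_fsum//; last 2 first.
  - move=> r; apply: emeasurable_funM; first exact/measurable_EFinP.
    exact/measurable_EFinP/measurableT_comp.
  - move=> r x _; apply: mule_ge0; first by rewrite lee_fin.
    by rewrite EFinM nnfun_muleindic_ge0.
apply: eq_fsbigr => r _; rewrite integralZl_indic_nnsfun//= integral_indic// setIT.
have mhr : measurable (h @^-1` [set r]) by [].
rewrite nuE//.
transitivity (\int[mu]_x (r%:E * ((f x)%:E * (\1_(h @^-1` [set r]) x)%:E))); last first.
  by apply: eq_integral => x _; rewrite EFinM muleCA.
have [r0|r0] := leP 0%R r.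
  rewrite ge0_integralZl//.
  - congr (_ * _); rewrite integral_mkcond; apply: eq_integral => x _.
    rewrite patchE indicE; case: ifPn => _; first by rewrite mule1.
    by rewrite mule0.
  - apply: emeasurable_funM; first exact/measurable_EFinP.
    exact/measurable_EFinP/measurable_indic.
  - by move=> x _; rewrite mule_ge0 ?lee_fin.
rewrite preimage_nnfun0// integral_set0 mule0 integral0_eq// => x _.
by rewrite indic0 !mule0.
Qed.

(** Integration against a measure nu of density f with respect to mu. *)
Lemma ge0_integral_density (g : T -> \bar R) :
  measurable_fun [set: T] g -> (forall x, 0 <= g x) ->
  \int[nu]_x g x = \int[mu]_x (g x * (f x)%:E).
Proof.
move=> mg g0; pose g_ := nnsfun_approx measurableT mg.
transitivity (lim (\int[nu]_x (g_ n x)%:E @[n --> \oo])).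
  rewrite -monotone_convergence//=.
  - apply: eq_integral => ? /[!inE] xD; apply/esym/cvg_lim => //=.
    exact: cvg_nnsfun_approx.
  - by move=> n; exact/measurable_EFinP/measurable_funTS.
  - by move=> n ? _; rewrite lee_fin.
  - by move=> ? _ ? ? mn; rewrite lee_fin; exact/lefP/nd_nnsfun_approx.
transitivity (lim (\int[mu]_x ((g_ n x)%:E * (f x)%:E) @[n --> \oo])).
  by apply: congr_lim; apply/funext => n; exact: integral_density_nnsfun.
rewrite -monotone_convergence//=.
- apply: eq_integral => x _; apply/cvg_lim => //.
  apply: cvgeZr => //; exact: cvg_nnsfun_approx.
- move=> n; apply: emeasurable_funM; exact/measurable_EFinP.
- by move=> n ? _; rewrite mule_ge0 ?lee_fin.
- move=> x _ m n mn; apply: lee_wpmul2r; rewrite ?lee_fin//.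
  exact/lefP/nd_nnsfun_approx.
Qed.

End density.

Section normal.
Context (R : realType).
Local Notation leb := (@lebesgue_measure R).
Local Notation N := (std_normal R).
Local Notation phi := (@normal_pdf R 0 1).
Local Open Scope ereal_scope.

Let mphi : measurable_fun [set: measurableTypeR R] phi.
Proof. exact: measurable_normal_pdf. Qed.

Lemma ge0_integral_std_normal (g : R -> \bar R) :
  measurable_fun [set: R] g -> (forall x, 0 <= g x) ->
  \int[N]_x g x = \int[leb]_x (g x * (phi x)%:E).
Proof.
move=> mg g0.
apply: (@ge0_integral_density _ (measurableTypeR R) R leb N phi mphi) => //.
by move=> x; exact: normal_pdf_ge0.
Qed.

Lemma phiE (x : R) : phi x = (normal_peak 1 * expR (- (x ^+ 2) / 2))%R.
Proof.
rewrite normal_pdfE ?oner_eq0// /normal_fun subr0; congr (_ * expR (_ / _))%R.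
by rewrite expr1n.
Qed.

Lemma std_normal_lipschitz (x y : R) : (x < y)%R ->
  N `]x, y]%classic <= (normal_peak 1 * (y - x))%:E.
Proof.
move=> xy.
apply: (@le_trans _ _ (\int[leb]_(z in `]x, y]%classic) (cst (normal_peak 1)%:E z))).
  apply: ge0_le_integral => //.
  - by move=> z _; rewrite lee_fin normal_pdf_ge0.
  - by apply/measurable_EFinP; exact: measurable_funTS.
  - by move=> z _; rewrite lee_fin normal_pdf_ub// oner_eq0.
by rewrite integral_cst//= lebesgue_measure_itv/= lte_fin xy -EFinB -EFinM.
Qed.

Lemma std_normal_sqr_integrable : \int[N]_x (x ^+ 2)%:E < +oo.
Proof.
rewrite ge0_integral_std_normal; last 2 first.
  - by apply/measurable_EFinP; exact: measurable_funX.
  - by move=> x; rewrite lee_fin sqr_ge0.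
(* Since x^2 <= 4 exp(x^2 / 4), the function x^2 phi(x) is at most a multiple
   of the density of N(0, 2), of standard deviation s. *)
pose s : R := Num.sqrt 2.
have s2 : (s ^+ 2 = 2)%R by rewrite sqr_sqrtr.
have s0 : s != 0%R by rewrite sqrtr_eq0 -ltNge.
pose c := (4 * normal_peak 1 / normal_peak s)%R.
apply: (@le_lt_trans _ _ (\int[leb]_x (c%:E * (normal_pdf 0 s x)%:E))).
  apply: ge0_le_integral => //.
  - by move=> x _; rewrite mule_ge0 ?lee_fin ?sqr_ge0 ?normal_pdf_ge0.
  - apply: emeasurable_funM; first by apply/measurable_EFinP; exact: measurable_funX.
    exact/measurable_EFinP.
  - apply: measurable_funeM; apply/measurable_EFinP; exact: measurable_normal_pdf.
  move=> x _; rewrite -!EFinM lee_fin phiE normal_pdfE// /normal_fun subr0 s2.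
  have p0 : (0 < normal_peak s)%R by exact: normal_peak_gt0.
  have p1 : (0 < normal_peak (1:R))%R by apply: normal_peak_gt0; rewrite oner_eq0.
  have -> : (c * (normal_peak s * expR (- x ^+ 2 / (2 *+ 2))) =
      normal_peak 1 * (4 * expR (- x ^+ 2 / (2 *+ 2))))%R.
    by rewrite /c; field; rewrite gt_eqF.
  rewrite mulrCA ler_pM2l//.
  have -> : (- x ^+ 2 / 2 = - x ^+ 2 / (2 *+ 2) + - (x ^+ 2 / 4))%R by field.
  rewrite expRD mulrA (mulrC (x ^+ 2)%R) -mulrA (mulrC 4%R) ler_pM2l ?expR_gt0//.
  rewrite expRN ler_pdivrMr ?expR_gt0//.
  by have := expR_ge1Dx (x ^+ 2 / 4); lra.
rewrite ge0_integralZl//.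
- by rewrite integral_normal_pdf mule1 ltry.
- by apply/measurable_EFinP; exact: measurable_normal_pdf.
- by move=> x _; rewrite lee_fin normal_pdf_ge0.
- by rewrite lee_fin divr_ge0 ?mulr_ge0 ?normal_peak_ge0.
Qed.

Lemma std_normal_nondegenerate : nondegenerate_L2 N.
Proof.
exact: (lipschitz_law std_normal_sqr_integrable std_normal_lipschitz).1.
Qed.

Lemma std_normal_continuous : continuous (dfun N).
Proof.
exact: (lipschitz_law std_normal_sqr_integrable std_normal_lipschitz).2.
Qed.

Lemma has_law_std_normalN (disp : measure_display) (T : measurableType disp)
    (P : probability T R) (X : T -> R) :
  has_law P X N -> has_law P (\- X)%R N.
Proof.
move=> lX; have [mX _] := lX.
have mNX : measurable_fun [set: T] (\- X)%R by exact: measurableT_comp.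
split=> // B mB.
have mB1 : measurable_fun setT (fun x : R => (\1_B x)%:E : \bar R).
  exact/measurable_EFinP/measurable_indic.
have mBN : measurable_fun setT (fun x : R => (\1_B (- x))%:E : \bar R).
  by apply: (measurableT_comp mB1); exact: oppr_measurable.
have NB : \int[N]_x (\1_B x)%:E = N B.
  by apply/esym; exact: (probability_preimage_indic N (X := fun x => x)).
rewrite probability_preimage_indic//.
rewrite (has_law_ge0_integral (f := fun x => (\1_B (- x))%:E) lX)//.
rewrite ge0_integral_std_normal//.
rewrite (@ge0_integral_affine R (-1) 0); last 3 first.
  - by rewrite oppr_eq0 oner_eq0.
  - by apply: emeasurable_funM => //; exact/measurable_EFinP.
  - by move=> x; rewrite mule_ge0// lee_fin normal_pdf_ge0.
rewrite normrN1 mul1e -[RHS]NB.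
transitivity (\int[leb]_x ((\1_B x)%:E * (phi x)%:E)); last first.
  by apply/esym; exact: ge0_integral_std_normal.
apply: eq_integral => x _; by rewrite addr0 mulN1r opprK !phiE sqrrN.
Qed.

(** The product of two standard normal densities is a function of x^2 + y^2, so
    rotation invariance gives the stability of the normal law. *)
Lemma has_law_std_normal_rot (d1 d2 : measure_display) (T1 : measurableType d1)
    (T2 : measurableType d2) (P1 : probability T1 R) (P2 : probability T2 R)
    (X : T1 -> R) (Y : T2 -> R) (a b : R) :
  (a ^+ 2 + b ^+ 2 = 1)%R -> has_law P1 X N -> has_law P2 Y N ->
  has_law (P1 \x P2) (fun z => a * X z.1 + b * Y z.2)%R N.
Proof.
move=> ab1 lX lY; have [mX _] := lX; have [mY _] := lY.
have mZ : measurable_fun setT (fun z : T1 * T2 => a * X z.1 + b * Y z.2)%R.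
  apply: measurable_funD; apply: measurable_funM => //.
    exact: measurableT_comp.
  exact: measurableT_comp.
split=> // B mB.
have mB1 : measurable_fun setT (fun x : R => (\1_B x)%:E : \bar R).
  exact/measurable_EFinP/measurable_indic.
have mBab : measurable_fun setT (fun z : R * R => (\1_B (a * z.1 + b * z.2))%:E : \bar R).
  apply: (measurableT_comp mB1).
  by apply: measurable_funD; exact: measurable_funM.
have NB : \int[N]_x (\1_B x)%:E = N B.
  by apply/esym; exact: (probability_preimage_indic N (X := fun x => x)).
rewrite probability_preimage_indic//.
transitivity (\int[P1]_x \int[P2]_y (\1_B (a * X x + b * Y y))%:E).
  apply: (fubini_tonelli1 (m1 := P1) (m2 := P2)
    (fun z => (\1_B (a * X z.1 + b * Y z.2))%:E)) => //.
  exact: (measurableT_comp mB1 mZ).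
transitivity (\int[P1]_x \int[N]_y (\1_B (a * X x + b * y))%:E).
  apply: eq_integral => x _.
  apply: (has_law_ge0_integral (f := fun y => (\1_B (a * X x + b * y))%:E) lY) => //.
  by apply: (measurableT_comp mB1); apply: measurable_funD => //; exact: measurable_funM.
transitivity (\int[N]_x \int[N]_y (\1_B (a * x + b * y))%:E).
  apply: (has_law_ge0_integral (f := fun x => \int[N]_y (\1_B (a * x + b * y))%:E) lX).
    exact: (measurable_fun_fubini_tonelli_F (m2 := N)
      (fun z : R * measurableTypeR R => (\1_B (a * z.1 + b * z.2))%:E)).
  by move=> x; exact: integral_ge0.
pose h (z : R * R) : \bar R :=
  (\1_B z.1 * (normal_peak 1 * normal_peak 1 * expR (- z.2 / 2)))%:E.
have mh : measurable_fun setT h.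
  apply/measurable_EFinP; apply: measurable_funM.
    by apply: measurableT_comp => //; exact: measurable_indic.
  apply: measurable_funM => //; apply: measurableT_comp => //.
  by apply: measurable_funM => //; exact: measurableT_comp.
have h0 z : 0 <= h z.
  by rewrite lee_fin mulr_ge0// !mulr_ge0 ?normal_peak_ge0 ?expR_ge0.
have hE u x y : (\1_B u)%:E * (phi y)%:E * (phi x)%:E = h (u, x ^+ 2 + y ^+ 2)%R.
  rewrite /h -!EFinM !phiE; congr EFin.
  have -> : (- (x ^+ 2 + y ^+ 2) / 2 = - x ^+ 2 / 2 + - y ^+ 2 / 2)%R by field.
  by rewrite expRD /=; ring.
have step (u : R -> R -> R) : measurable_fun [set: R * R] (fun z => u z.1 z.2) ->
    \int[N]_x \int[N]_y (\1_B (u x y))%:E =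
    \int[leb]_x \int[leb]_y h (u x y, x ^+ 2 + y ^+ 2)%R.
  move=> mu.
  have mBu : measurable_fun setT (fun z : R * R => (\1_B (u z.1 z.2))%:E : \bar R).
    exact: (measurableT_comp mB1 mu).
  rewrite ge0_integral_std_normal; last 2 first.
    - exact: (measurable_fun_fubini_tonelli_F (m2 := N)
        (fun z : R * measurableTypeR R => (\1_B (u z.1 z.2))%:E)).
    - by move=> x; exact: integral_ge0.
  apply: eq_integral => x _.
  have mBux : measurable_fun setT (fun y : R => (\1_B (u x y))%:E : \bar R).
    exact: (measurable_fun_pair2 (f := fun z : R * R => (\1_B (u z.1 z.2))%:E)).
  rewrite ge0_integral_std_normal//.
  rewrite -ge0_integralZr//.
  - by apply: eq_integral => y _; rewrite hE.
  - by apply: emeasurable_funM => //; exact/measurable_EFinP.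
  - by move=> y _; rewrite mule_ge0// lee_fin normal_pdf_ge0.
  - by rewrite lee_fin normal_pdf_ge0.
rewrite (step (fun x y => a * x + b * y)%R); last first.
  by apply: measurable_funD; exact: measurable_funM.
rewrite (integral_rotation2 ab1 mh h0) -(step (fun x y => x)); last first.
  exact: measurable_fst.
rewrite -[RHS]NB.
apply: eq_integral => x _; rewrite integral_cst//.
by rewrite -[X in _ * X]/(N setT) probability_setT mule1.
Qed.

(** Standard Gaussian vectors, of which only the laws of the normalized linear
    combinations of the components are needed. *)
Lemma gaussian_vector n :
  exists (disp : measure_display) (T : measurableType disp)
    (P : probability T R) (Z : 'I_n -> T -> R),
    forall v : 'I_n -> R, (\sum_k v k ^+ 2 = 1)%R ->
      has_law P (fun t => \sum_k v k * Z k t)%R N.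
Proof.
elim: n => [|n [d [T [P [Z hZ]]]]].
  exists _, (measurableTypeR R), N, (fun _ _ => 0%R) => v.
  by rewrite big_ord0 => /eqP; rewrite eq_sym oner_eq0.
exists _, (measurableTypeR R * T)%type, (N \x P)%E.
exists (fun k z => if unlift ord0 k is Some j then Z j z.2 else z.1) => v.
rewrite big_ord_recl => v1.
have sumE z : (\sum_(k < n.+1) v k * (if unlift ord0 k is Some j then Z j z.2 else z.1) =
    v ord0 * z.1 + \sum_(j < n) v (lift ord0 j) * Z j z.2)%R.
  rewrite big_ord_recl unlift_none; congr (_ + _)%R.
  by apply: eq_bigr => j _; rewrite liftK.
rewrite (_ : (fun z => _) = (fun z : measurableTypeR R * T =>
  v ord0 * z.1 + \sum_(j < n) v (lift ord0 j) * Z j z.2)%R); last exact/funext.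
pose q : R := (\sum_(j < n) v (lift ord0 j) ^+ 2)%R.
have q0 : (0 <= q)%R by apply: sumr_ge0 => j _; exact: sqr_ge0.
have lN := has_law_id N.
have [qz|qn] := eqVneq q 0%R.
  have vz j : v (lift ord0 j) = 0%R.
    move: qz => /eqP; rewrite psumr_eq0; last by move=> k _; exact: sqr_ge0.
    by move=> /allP/(_ j); rewrite mem_index_enum sqrf_eq0 => /(_ isT)/eqP.
  have := v1; rewrite -/q qz addr0 => /eqP.
  have lfst := has_law_fst P lN.
  rewrite sqrf_eq1 => /orP[] /eqP v01.
    rewrite (_ : (fun z => _) = (fun z : measurableTypeR R * T => z.1))//.
    by apply/funext => z; rewrite v01 mul1r big1 ?addr0// => j _; rewrite vz mul0r.
  rewrite (_ : (fun z => _) = (\- (fun z : measurableTypeR R * T => z.1 : R))%R).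
    exact: has_law_std_normalN.
  by apply/funext => z; rewrite v01 mulN1r big1 ?addr0// => j _; rewrite vz mul0r.
pose s := Num.sqrt q.
have s2 : (s ^+ 2 = q)%R by rewrite sqr_sqrtr.
have s0 : s != 0%R by rewrite -sqrf_eq0 s2.
have [|m l] := hZ (fun j => v (lift ord0 j) / s)%R.
  under eq_bigr do rewrite exprMn exprVn s2.
  by rewrite -mulr_suml divff.
have v1' : (v ord0 ^+ 2 + s ^+ 2 = 1)%R by rewrite s2.
have := has_law_std_normal_rot v1' lN (conj m l).
congr (has_law _ _ _); apply/funext => z /=; congr (_ + _)%R.
by rewrite mulr_sumr; apply: eq_bigr => j _; rewrite mulrA mulrCA divff// mulr1.
Qed.

End normal.

(** * Gram matrices as correlation matrices *)

(** If all the combinations m + v . Z with v a unit vector have law mu, then the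
    variables m + v_i . Z have correlations v_i . v_j: the variance of w . Z is
    proportional to the squared norm of w. *)
Lemma gram_correlation_matrix (disp : measure_display) (T : measurableType disp)
    (R : realType) (P : probability T R)
    (mu : probability (measurableTypeR R) R) (m : R) r (Z : 'I_r -> T -> R) :
  nondegenerate_L2 mu ->
  (forall v : 'I_r -> R, \sum_k v k ^+ 2 = 1 ->
    has_law P (fun t => m + \sum_k v k * Z k t) mu) ->
  forall d (V : 'M[R]_(d, r)), (forall i, (V *m V^T) i i = 1) ->
  correlation_matrices_of mu d (V *m V^T).
Proof.
move=> mu2 lZ d V V1.
pose L (v : 'I_r -> R) t := \sum_k v k * Z k t.
have VVE i j : (V *m V^T) i j = \sum_k V i k * V j k.
  by rewrite mxE; apply: eq_bigr => k _; rewrite mxE.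
have lX i : has_law P (fun t => m + L (V i) t) mu.
  by apply: lZ; rewrite -[RHS](V1 i) VVE; apply: eq_bigr => k _; rewrite expr2.
have := pearson_matrix_of_law lX.
congr correlation_matrices_of; apply/matrixP => i j; rewrite mxE VVE.
have s0 := law_variance_gt0 mu2.
have L2 v : \sum_k v k ^+ 2 = 1 -> L v \in Lfun P 2%:E.
  move=> v1; have h := has_law_L2 mu2 (lZ v v1).
  rewrite (_ : L v = (fun t => m + L v t) \- cst m).
    have c2 : cst m \in Lfun P 2%:E by exact: Lfun_cst.
    by rewrite rpredB// lee1n.
  by apply/funext => t /=; rewrite addrAC subrr add0r.
have VL v : \sum_k v k ^+ 2 = 1 -> 'V_P[L v] = (law_variance mu)%:E.
  move=> v1; rewrite -(has_law_variance mu2 (lZ v v1)).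
  by rewrite -(@varianceD_cst_l _ _ _ _ m) ?L2.
have VLw w : 'V_P[L w] = ((\sum_k w k ^+ 2) * law_variance mu)%:E.
  pose q := \sum_k w k ^+ 2; rewrite -/q.
  have q0 : 0 <= q by apply: sumr_ge0 => k _; exact: sqr_ge0.
  have [qz|qn] := eqVneq q 0.
    rewrite qz mul0r (_ : L w = cst 0) ?variance_cst//.
    apply/funext => t; rewrite /L big1// => k _.
    move: qz => /eqP; rewrite psumr_eq0; last by move=> ? _; exact: sqr_ge0.
    move=> /allP/(_ k); rewrite mem_index_enum sqrf_eq0 => /(_ isT)/eqP ->.
    by rewrite mul0r.
  pose s := Num.sqrt q.
  have s2 : s ^+ 2 = q by rewrite sqr_sqrtr.
  have sn : s != 0 by rewrite -sqrf_eq0 s2.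
  have v1 : \sum_k (w k / s) ^+ 2 = 1.
    under eq_bigr do rewrite exprMn exprVn s2.
    by rewrite -mulr_suml divff.
  rewrite (_ : L w = s \o* L (fun k => w k / s)).
    by rewrite varianceZ ?L2// VL// s2 EFinM.
  apply/funext => t; rewrite /L /= mulr_suml; apply: eq_bigr => k _.
  by rewrite mulrAC divfK.
rewrite (pearson_sum s0) ?(has_law_L2 mu2)//; try exact: has_law_variance.
have -> : (fun t => m + L (V i) t) \+ (fun t => m + L (V j) t) =
    cst (m + m) \+ L (fun k => V i k + V j k).
  apply/funext => t; rewrite /= addrACA; congr (_ + _).
  by rewrite /L -big_split; apply: eq_bigr => k _; rewrite mulrDl.
rewrite varianceD_cst_l; last first.
  rewrite (_ : L _ = ((fun t => m + L (V i) t) \+ (fun t => m + L (V j) t)) \- cst (m + m)).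
    have h1 := has_law_L2 mu2 (lX i); have h2 := has_law_L2 mu2 (lX j).
    have c2 : cst (m + m) \in Lfun P 2%:E by exact: Lfun_cst.
    have h12 : (fun t => m + L (V i) t) \+ (fun t => m + L (V j) t) \in Lfun P 2%:E.
      by rewrite rpredD// lee1n.
    by rewrite rpredB// lee1n.
  apply/funext => t; transitivity (L (V i) t + L (V j) t); last by rewrite /=; ring.
  by rewrite /L -big_split; apply: eq_bigr => k _; rewrite mulrDl.
rewrite VLw /= mulfK ?gt_eqF//.
have -> : \sum_k (V i k + V j k) ^+ 2 = 2 + 2 * \sum_k V i k * V j k.
  transitivity (\sum_k (V i k * V i k + V j k * V j k + 2 * (V i k * V j k))).
    by apply: eq_bigr => k _; ring.
  by rewrite !big_split -mulr_sumr /= -!VVE !V1.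
by field.
Qed.

(** * The uniform law on the unit ball *)

Lemma product_measure_section (d1 d2 : measure_display) (T1 : measurableType d1)
    (T2 : measurableType d2) (R : realType)
    (m1 : {measure set T1 -> \bar R}) (m2 : {sigma_finite_measure set T2 -> \bar R})
    (E : set (T1 * T2)) :
  (m1 \x m2)%E E = (\int[m1]_x m2 [set y | E (x, y)])%E.
Proof.
apply: eq_integral => x _ /=; congr (m2 _).
by apply/seteqP; split => p; rewrite /xsection /= inE.
Qed.

Lemma conditional_probability (disp : measure_display) (T : measurableType disp)
    (R : realType) (m : {measure set T -> \bar R}) (D : set T) :
  measurable D -> m D \is a fin_num -> (0 < m D)%E ->
  exists P : probability T R, forall E, measurable E ->
    P E = ((fine (m D))^-1%:E * m (E `&` D))%E.
Proof.
move=> mD finD posD.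
exists (mnormalize (mrestr m mD) (@dirac _ _ point R)) => E mE.
rewrite /= /mnormalize /= /mrestr setTI.
rewrite gt_eqF//= (_ : (m D == +oo%E) = false); last first.
  by apply/negbTE; rewrite -ltey -ge0_fin_numE.
by rewrite muleC.
Qed.

Section sphere.
Context (R : realType).
Local Notation mR := (measurableTypeR R).
Local Notation leb := (@lebesgue_measure R).
Local Notation leb2 := (leb \x leb)%E.
Local Notation leb3 := (leb \x (leb \x leb))%E.
Local Open Scope ereal_scope.

Let leb_indic (F : set mR) : measurable F -> leb F = \int[leb]_y (\1_F y)%:E.
Proof. by move=> mF; rewrite integral_indic// setIT. Qed.

Lemma leb2E (E : set (mR * mR)) : measurable E ->
  leb2 E = \int[leb]_x \int[leb]_y (\1_E (x, y))%:E.
Proof.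
move=> mE; rewrite product_measure_section; apply: eq_integral => x _.
apply: leb_indic.
rewrite -[X in measurable X]setTI; exact: (pair1_measurable x).
Qed.

Let leb3_section (E : set (mR * (mR * mR))) :
  leb3 E = \int[leb]_x leb2 [set p | E (x, p)].
Proof.
apply: eq_integral => x _ /=; congr (leb2 _).
by apply/seteqP; split => p; rewrite /xsection /= inE.
Qed.

Lemma leb3E (E : set (mR * (mR * mR))) : measurable E ->
  leb3 E = \int[leb]_x \int[leb]_y \int[leb]_z (\1_E (x, (y, z)))%:E.
Proof.
move=> mE; rewrite leb3_section; apply: eq_integral => x _.
apply: leb2E.
rewrite -[X in measurable X]setTI; exact: (pair1_measurable x).
Qed.

(** The squared norm of a point of the plane. *)
Definition sqn2 (p : mR * mR) : R := (p.1 ^+ 2 + p.2 ^+ 2)%R.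

Lemma measurable_sqn2 : measurable_fun [set: mR * mR] sqn2.
Proof. by apply: measurable_funD; apply: measurable_funX. Qed.

Lemma measurable_sqn2_preimage (B : set R) : measurable B -> measurable (sqn2 @^-1` B).
Proof. by move=> mB; rewrite -[X in measurable X]setTI; exact: measurable_sqn2. Qed.

(** The area of a disc is proportional to its squared radius. *)
Lemma disc_scaling (rho : R) : (0 < rho)%R ->
  leb2 (sqn2 @^-1` `]-oo, rho]) = rho%:E * leb2 (sqn2 @^-1` `]-oo, 1%R]).
Proof.
move=> rho0; pose s := Num.sqrt rho.
have s2 : (s ^+ 2 = rho)%R by rewrite sqr_sqrtr// ltW.
have s0 : (0 < s)%R by rewrite sqrtr_gt0.
have sn0 : s != 0%R by rewrite gt_eqF.
have mD (r : R) : measurable (sqn2 @^-1` `]-oo, r]) by exact: measurable_sqn2_preimage.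
pose f (x y : R) : \bar R := (\1_(`]-oo, rho]%classic : set R) (x ^+ 2 + y ^+ 2))%:E.
pose g (x y : R) : \bar R := (\1_(`]-oo, 1%R]%classic : set R) (x ^+ 2 + y ^+ 2))%:E.
have f0 x y : 0 <= f x y by rewrite lee_fin.
have g0 x y : 0 <= g x y by rewrite lee_fin.
have fg x y : f (s * x + 0)%R (s * y + 0)%R = g x y.
  rewrite /f /g !addr0 !exprMn s2 -mulrDr !indicE !mem_setE !in_itv/=.
  by rewrite -ler_pdivlMl// mulVf// gt_eqF.
have m2 (r : R) : measurable_fun setT
    (fun p : mR * mR => (\1_(`]-oo, r]%classic : set R) (p.1 ^+ 2 + p.2 ^+ 2))%:E : \bar R).
  apply/measurable_EFinP; apply: measurableT_comp; first exact: measurable_indic.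
  exact: measurable_sqn2.
have mfx x : measurable_fun setT (f x).
  exact: (measurable_fun_pair2 (f := fun p : mR * mR => f p.1 p.2) x (m2 rho)).
have mgx x : measurable_fun setT (g x).
  exact: (measurable_fun_pair2 (f := fun p : mR * mR => g p.1 p.2) x (m2 1%R)).
have mF : measurable_fun setT (fun x : mR => \int[leb]_y f x y).
  apply: (measurable_fun_fubini_tonelli_F (m2 := leb) (fun p : mR * mR => f p.1 p.2)).
    exact: m2.
  by move=> p; exact: f0.
have mG : measurable_fun setT (fun x : mR => \int[leb]_y g x y).
  apply: (measurable_fun_fubini_tonelli_F (m2 := leb) (fun p : mR * mR => g p.1 p.2)).
    exact: m2.
  by move=> p; exact: g0.
rewrite (leb2E (mD rho)) (leb2E (mD 1%R)).
transitivity (\int[leb]_x \int[leb]_y f x y); first by [].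
transitivity (rho%:E * \int[leb]_x \int[leb]_y g x y); last by [].
rewrite (ge0_integral_affine 0 sn0 mF); last by move=> x; exact: integral_ge0.
have -> : rho%:E = s%:E * s%:E by rewrite -EFinM -expr2 s2.
rewrite (gtr0_norm s0) -muleA; congr (_ * _).
transitivity (\int[leb]_x (s%:E * \int[leb]_y g x y)).
  apply: eq_integral => x _.
  rewrite (ge0_integral_affine 0 sn0 (mfx _)); last by move=> y; exact: f0.
  by rewrite (gtr0_norm s0); congr (_ * _); apply: eq_integral => y _; exact: fg.
apply: ge0_integralZl; [exact: measurableT|exact: mG| |].
  by move=> x _; apply: integral_ge0 => y _; exact: g0.
by rewrite lee_fin ltW.
Qed.

Lemma disc_le0 (rho : R) : (rho <= 0)%R -> leb2 (sqn2 @^-1` `]-oo, rho]) = 0.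
Proof.
move=> rho0.
have : leb2 ([set 0%R] `*` [set 0%R]) = 0.
  have -> : leb2 ([set 0%R] `*` [set 0%R]) = leb [set 0%R] * leb [set 0%R].
    by apply: product_measure1E; exact: measurable_set1.
  by rewrite lebesgue_measure_set1 mul0e.
apply: subset_measure0; first exact: measurable_sqn2_preimage.
  exact: measurableX.
move=> [x y] /=; rewrite in_itv/= /sqn2/= => h.
have : (x ^+ 2 + y ^+ 2 == 0)%R.
  by rewrite eq_le (le_trans h)//= addr_ge0// sqr_ge0.
by rewrite paddr_eq0 ?sqr_ge0// !sqrf_eq0 => /andP[/eqP-> /eqP->].
Qed.

Let square (a : R) : (0 < a)%R ->
  leb2 (`[(- a)%R, a] `*` `[(- a)%R, a]) = ((2 * a) ^+ 2)%:E.
Proof.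
move=> a0.
have -> : leb2 (`[(- a)%R, a] `*` `[(- a)%R, a]) =
    leb `[(- a)%R, a] * leb `[(- a)%R, a].
  by apply: product_measure1E; exact: measurable_itv.
rewrite lebesgue_measure_itv/= lte_fin gtrN// -EFinB -EFinM; congr EFin; ring.
Qed.

(** The area of the unit disc. Its value, pi, is not needed. *)
Definition disc_area : R := fine (leb2 (sqn2 @^-1` `]-oo, 1%R])).
Local Notation c := disc_area.

Let disc1_fin : leb2 (sqn2 @^-1` `]-oo, 1%R]) \is a fin_num.
Proof.
rewrite ge0_fin_numE//.
apply: (@le_lt_trans _ _ (leb2 (`[(- 1)%R, 1%R] `*` `[(- 1)%R, 1%R]))); last first.
  by rewrite square// ltry.
apply: le_measure; rewrite ?inE.
- exact: measurable_sqn2_preimage.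
- exact: measurableX.
move=> [x y] /=; rewrite !in_itv/= /sqn2/= => h.
have h1 : (x ^+ 2 <= 1)%R by apply: le_trans h; rewrite lerDl sqr_ge0.
have h2 : (y ^+ 2 <= 1)%R by apply: le_trans h; rewrite lerDr sqr_ge0.
by split; apply/andP; split; nra.
Qed.

Lemma disc_area_gt0 : (0 < c)%R.
Proof.
rewrite -lte_fin fineK; last exact: disc1_fin.
apply: (@lt_le_trans _ _ (leb2 (`[(- 2^-1)%R, 2^-1%R] `*` `[(- 2^-1)%R, 2^-1%R]))).
  by rewrite square ?invr_gt0// lte_fin divff ?expr1n.
apply: le_measure; rewrite ?inE.
- exact: measurableX.
- exact: measurable_sqn2_preimage.
move=> [x y] /=; rewrite !in_itv/= /sqn2/= => -[/andP[h1 h2] /andP[h3 h4]].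
nra.
Qed.

Lemma disc_measure (rho : R) :
  leb2 (sqn2 @^-1` `]-oo, rho]) = (c * Num.max 0 rho)%:E.
Proof.
have [rho0|rho0] := leP rho 0%R; first by rewrite disc_le0// mulr0.
by rewrite disc_scaling// -(fineK disc1_fin) mulrC EFinM.
Qed.

Lemma annulus_measure (rho0 rho1 : R) : (0 <= rho0)%R ->
  leb2 (sqn2 @^-1` `]rho0, rho1]) = (c * Num.max 0 (rho1 - rho0))%:E.
Proof.
move=> r0; have [r10|r01] := leP rho1 rho0.
  rewrite set_itv_ge ?preimage_set0 ?measure0; last by rewrite bnd_simp -leNgt.
  by rewrite (max_idPl _) ?mulr0// subr_le0.
have -> : sqn2 @^-1` `]rho0, rho1] = sqn2 @^-1` `]-oo, rho1] `\` sqn2 @^-1` `]-oo, rho0].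
  apply/seteqP; split=> p /=; rewrite !in_itv/=.
    by move=> /andP[h ->]; split=> //; apply/negP; rewrite -ltNge.
  by move=> [-> /negP]; rewrite -ltNge => ->.
have -> : leb2 (sqn2 @^-1` `]-oo, rho1] `\` sqn2 @^-1` `]-oo, rho0]) =
    leb2 (sqn2 @^-1` `]-oo, rho1]) -
    leb2 (sqn2 @^-1` `]-oo, rho1] `&` sqn2 @^-1` `]-oo, rho0]).
  apply: measureD; [exact: measurable_sqn2_preimage..|].
  have h : leb2 (sqn2 @^-1` `]-oo, rho1]) < +oo by rewrite disc_measure ltry.
  exact: h.
rewrite setIidr; last first.
  by move=> p /=; rewrite !in_itv/= => /le_trans; apply; exact: ltW.
rewrite !disc_measure -EFinB; congr EFin.
rewrite (max_idPr r0) (max_idPr (le_trans r0 (ltW r01))).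
by rewrite (max_idPr _) ?mulrBr// subr_ge0 ltW.
Qed.

(** The squared norm of a point of space, seen as a point of R * (R * R), and
    its scalar product with (a, b, d). *)
Definition sqn3 (z : mR * (mR * mR)) : R := (z.1 ^+ 2 + z.2.1 ^+ 2 + z.2.2 ^+ 2)%R.

Definition lin3 (a b d : R) (z : mR * (mR * mR)) : R :=
  (a * z.1 + b * z.2.1 + d * z.2.2)%R.

Lemma measurable_sqn3 : measurable_fun [set: mR * (mR * mR)] sqn3.
Proof.
apply: measurable_funD; first apply: measurable_funD; apply: measurable_funX => //.
  by apply: measurableT_comp.
by apply: measurableT_comp.
Qed.

Lemma measurable_lin3 a b d : measurable_fun [set: mR * (mR * mR)] (lin3 a b d).
Proof.
apply: measurable_funD; first apply: measurable_funD; apply: measurable_funM => //.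
  by apply: measurableT_comp.
by apply: measurableT_comp.
Qed.

(** Rotation invariance of the volume of sets defined by a linear form and the
    norm. *)
Lemma leb3_rotation (a b d : R) (H : set (R * R)) : measurable H ->
  (a ^+ 2 + b ^+ 2 + d ^+ 2 = 1)%R ->
  leb3 [set z | H (lin3 a b d z, sqn3 z)] = leb3 [set z | H (z.1, sqn3 z)].
Proof.
move=> mH abd.
have mpre (l : mR * (mR * mR) -> R) : measurable_fun setT l ->
    measurable [set z | H (l z, sqn3 z)].
  move=> ml; rewrite -[X in measurable X]setTI.
  exact: (measurable_fun_pair ml measurable_sqn3).
rewrite !leb3E; [|exact: mpre..|]; last by apply: mpre; exact: measurable_lin3.
pose h (p : R * R) : \bar R := (\1_H p)%:E.
have mh : measurable_fun setT h by apply/measurable_EFinP; exact: measurable_indic.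
have h0 p : 0 <= h p by rewrite lee_fin.
exact: (integral_rotation3 abd mh h0).
Qed.

(** The unit ball. *)
Definition ball3 : set (mR * (mR * mR)) := sqn3 @^-1` `]-oo, 1%R].

Lemma measurable_ball3 : measurable ball3.
Proof. by rewrite -[X in measurable X]setTI; exact: measurable_sqn3. Qed.

(* the area of the section of the unit ball at height x *)
Let prof (x : R) : R := (c * Num.max 0 (1 - x ^+ 2))%R.

Let mprof : measurable_fun [set: R] prof.
Proof.
apply: measurable_funM => //; apply: measurable_maxr => //.
by apply: measurable_funB => //; exact: measurable_funX.
Qed.

Let prof_ge0 x : (0 <= prof x)%R.
Proof. by rewrite mulr_ge0 ?(ltW disc_area_gt0)// le_max lexx. Qed.

Lemma leb3_ball3 : leb3 ball3 = \int[leb]_x (prof x)%:E.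
Proof.
rewrite leb3_section; apply: eq_integral => x _; rewrite -disc_measure.
congr (leb2 _); apply/seteqP; split=> p; rewrite /ball3 /= !in_itv/= /sqn3 /sqn2 /=.
  by move=> h; lra.
by move=> h; lra.
Qed.

Let sqr_gt1 (x : R) : ~~ (-1 <= x <= 1)%R -> (1 - x ^+ 2 <= 0)%R.
Proof. by rewrite negb_and -!ltNge => /orP[|] h; nra. Qed.

Lemma leb3_ball3_fin : leb3 ball3 \is a fin_num.
Proof.
rewrite leb3_ball3 ge0_fin_numE; last by apply: integral_ge0 => x _; rewrite lee_fin.
apply: (@le_lt_trans _ _ (\int[leb]_x (c%:E * (\1_(`[(-1)%R, 1%R] : set R) x)%:E))).
  apply: ge0_le_integral => //.
  - by move=> x _; rewrite lee_fin.
  - exact/measurable_EFinP.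
  - apply: measurable_funeM; apply/measurable_EFinP; exact: measurable_indic.
  move=> x _; rewrite -EFinM lee_fin /prof ler_pM2l ?disc_area_gt0//.
  rewrite indicE mem_setE in_itv/= ge_max; apply/andP; split=> //.
  have [_|] := boolP (_ <= x <= _)%R; first by rewrite gerBl sqr_ge0.
  exact: sqr_gt1.
rewrite ge0_integralZl//.
- rewrite -leb_indic// lebesgue_measure_itv/= lte_fin gtrN//.
  by rewrite -EFinB -EFinM ltry.
- by apply/measurable_EFinP; exact: measurable_indic.
- by rewrite lee_fin ltW// disc_area_gt0.
Qed.

(** The volume of the unit ball. *)
Definition ball_volume : R := fine (leb3 ball3).
Local Notation V := ball_volume.

Lemma leb3_ball3_gt0 : 0 < leb3 ball3.
Proof.
rewrite leb3_ball3.
apply: (@lt_le_trans _ _ (\int[leb]_x ((c * 2^-1)%:E * (\1_(`[(- 2^-1)%R, 2^-1%R] : set R) x)%:E))).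
  rewrite ge0_integralZl//.
  - rewrite -leb_indic// lebesgue_measure_itv/= lte_fin gtrN ?invr_gt0//.
    by rewrite -EFinB -EFinM lte_fin !mulr_gt0 ?disc_area_gt0 ?invr_gt0//; lra.
  - by apply/measurable_EFinP; exact: measurable_indic.
  - by rewrite lee_fin mulr_ge0 ?invr_ge0// ltW// disc_area_gt0.
apply: ge0_le_integral => //.
- by move=> x _; rewrite mule_ge0// lee_fin mulr_ge0 ?invr_ge0// ltW// disc_area_gt0.
- apply: measurable_funeM; apply/measurable_EFinP; exact: measurable_indic.
- exact/measurable_EFinP.
move=> x _; rewrite -EFinM lee_fin /prof -mulrA ler_pM2l ?disc_area_gt0//.
rewrite indicE mem_setE in_itv/=.
have [|_] := boolP (_ <= x <= _)%R; last by rewrite mulr0 le_max lexx.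
move=> /andP[h1 h2]; rewrite mulr1 le_max; apply/orP; right; nra.
Qed.

Lemma ball_volume_gt0 : (0 < V)%R.
Proof. by rewrite -lte_fin (fineK leb3_ball3_fin) leb3_ball3_gt0. Qed.

(** * Projections of the sphere are uniform *)

(** The inverse of the norm, as a function of the squared norm r: it is
    r^(-1/2) for r > 0, and 0 for r = 0. *)
Definition inv_norm (r : R) : R := (r `^ (- 2^-1))%R.
Local Notation k := inv_norm.

Let mk : measurable_fun [set: R] k.
Proof. exact: measurable_powR. Qed.

Let k_sqr (r : R) : (0 < r)%R -> (k r ^+ 2 = r^-1)%R.
Proof.
move=> r0; rewrite /k powRN exprVn -powR_mulrn ?powR_ge0// -powRrM.
by rewrite mulVf// powRr1// ltW.
Qed.

Let unit_lt (x r t : R) : (0 < r)%R -> (0 < t)%R ->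
  (`|x * k r| < t)%R = (x ^+ 2 < t ^+ 2 * r)%R.
Proof.
move=> r0 t0; rewrite -(@ltr_pXn2r _ 2)// ?nnegrE ?(ltW t0)//.
by rewrite real_normK ?num_real// exprMn k_sqr// ltr_pdivrMr.
Qed.

(** Archimedes' theorem: in the unit ball, the cone |z.1| < t |z| has a fraction t
    of the volume. Its section at height x is an annulus of the same area as the
    section of the ball at height x / t. *)
Lemma slab_measure (t : R) : (0 < t < 1)%R ->
  leb3 [set z | (`|z.1 * k (sqn3 z)| < t)%R /\ (sqn3 z <= 1)%R] = (t * V)%:E.
Proof.
move=> /andP[t0 t1]; have tn0 : t^-1%R != 0%R by rewrite invr_eq0 gt_eqF.
have tn := gt_eqF t0.
rewrite leb3_section.
transitivity (\int[leb]_x (prof (t^-1 * x + 0)%R)%:E); last first.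
  have VE : V%:E = `|t^-1|%:E * \int[leb]_x (prof (t^-1 * x + 0)%R)%:E.
    rewrite (fineK leb3_ball3_fin) leb3_ball3.
    apply: (@ge0_integral_affine R t^-1%R 0%R tn0 (fun x => (prof x)%:E)).
      exact/measurable_EFinP.
    by move=> x; rewrite lee_fin.
  rewrite mulrC EFinM VE gtr0_norm ?invr_gt0// muleC muleA -EFinM.
  by rewrite divff ?tn// mul1e.
apply: eq_integral => x _.
have -> : (prof (t^-1 * x + 0) = c * Num.max 0 (1 - x ^+ 2 / t ^+ 2))%R.
  by rewrite /prof addr0 exprMn exprVn [(_^-1 * _)%R]mulrC.
have [x0|x0] := eqVneq x 0%R.
  rewrite x0 expr0n/= mul0r subr0 -disc_measure.
  congr (leb2 _); apply/seteqP; split => p;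
    rewrite /= in_itv/= /sqn3 /sqn2/= expr0n/= add0r mul0r normr0.
    by case.
  by [].
have x2 : (0 < x ^+ 2)%R by rewrite exprn_even_gt0.
have t2 : (0 < t ^+ 2)%R by rewrite exprn_gt0.
have t21 : (t ^+ 2 < 1)%R by rewrite expr_lt1// ltW.
have -> : (1 - x ^+ 2 / t ^+ 2 = (1 - x ^+ 2) - (x ^+ 2 / t ^+ 2 - x ^+ 2))%R by ring.
rewrite -annulus_measure; last first.
  by rewrite subr_ge0 ler_pdivlMr// ger_pMr// ltW.
congr (leb2 _); apply/seteqP; split => p; rewrite /= in_itv/= /sqn3 /sqn2/= -addrA.
  have r0 : (0 < x ^+ 2 + (p.1 ^+ 2 + p.2 ^+ 2))%R.
    by rewrite ltr_pwDl// addr_ge0// sqr_ge0.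
  rewrite unit_lt// => -[h1 h2]; apply/andP; split; last by lra.
  by rewrite ltrBlDr ltr_pdivrMr// [ltRHS]mulrC [(_ + x ^+ 2)%R]addrC.
have r0 : (0 < x ^+ 2 + (p.1 ^+ 2 + p.2 ^+ 2))%R.
  by rewrite ltr_pwDl// addr_ge0// sqr_ge0.
rewrite unit_lt// => /andP[h1 h2]; split; last by lra.
by move: h1; rewrite ltrBlDr ltr_pdivrMr// [ltRHS]mulrC [(_ + x ^+ 2)%R]addrC.
Qed.

Let leb2_sigma_finite : sigma_finite setT (leb2 : set (mR * mR)%type -> \bar R).
Proof.
exists (fun n => `[(- n.+1%:R)%R, n.+1%:R] `*` `[(- n.+1%:R)%R, n.+1%:R]); last first.
  move=> n; split; first by apply: measurableX; exact: measurable_itv.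
  by rewrite square// ltry.
apply/esym; rewrite -subTset => -[x y] _.
exists (Num.bound (`|x| + `|y|)%R) => //.
have h : (`|x| + `|y| <= (Num.bound (`|x| + `|y|)).+1%:R)%R.
  rewrite (le_trans (ltW (archi_boundP _))) ?addr_ge0// ler_nat//.
by split; rewrite /= in_itv/= -ler_norml; apply: le_trans h; rewrite ?lerDl ?lerDr.
Qed.

(** The uniform probability on the unit ball. *)
Lemma uniform_ball : exists P : probability (mR * (mR * mR))%type R,
  forall E, measurable E -> P E = (V^-1)%:E * leb3 (E `&` ball3).
Proof.
pose l : {measure set (mR * mR)%type -> \bar R} := leb2.
pose H1 := Measure_isSigmaFinite.Build _ _ _ l leb2_sigma_finite.
pose l2 : {sigma_finite_measure set (mR * mR)%type -> \bar R} :=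
  HB.pack (Measure.sort l) H1.
exact: (@conditional_probability _ _ R (product_measure1 leb l2) ball3
  measurable_ball3 leb3_ball3_fin leb3_ball3_gt0).
Qed.

Section direction.
Variable P : probability (mR * (mR * mR))%type R.
Hypothesis PE : forall E, measurable E -> P E = (V^-1)%:E * leb3 (E `&` ball3).

Let mU (l : mR * (mR * mR) -> R) : measurable_fun setT l ->
  measurable_fun setT (fun z => l z * k (sqn3 z))%R.
Proof.
by move=> ml; apply: measurable_funM => //; apply: measurableT_comp => //; exact: measurable_sqn3.
Qed.

Let mfst : measurable_fun setT (fun z : mR * (mR * mR) => z.1 : R).
Proof. exact: measurable_fst. Qed.

(** For z uniform in the ball, z / |z| is uniform on the sphere: its scalar
    products with unit vectors all have the same law. *)
Lemma direction_rotation (a b d : R) (S : set R) : measurable S ->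
  (a ^+ 2 + b ^+ 2 + d ^+ 2 = 1)%R ->
  P ((fun z => lin3 a b d z * k (sqn3 z))%R @^-1` S) =
  P ((fun z => z.1 * k (sqn3 z))%R @^-1` S).
Proof.
move=> mS abd.
have mp (l : mR * (mR * mR) -> R) : measurable_fun setT l ->
    measurable ((fun z => l z * k (sqn3 z))%R @^-1` S).
  by move=> ml; rewrite -[X in measurable X]setTI; exact: mU.
rewrite !PE; [|exact: mp|apply: mp; exact: measurable_lin3].
pose H := ((fun p : R * R => p.1 * k p.2)%R @^-1` S) `&` (snd @^-1` `]-oo, 1%R]).
have mH : measurable H.
  apply: measurableI; rewrite -[X in measurable X]setTI.
    have mf : measurable_fun [set: R * R] (fun p : R * R => p.1 * k p.2)%R.
      by apply: measurable_funM => //; exact: measurableT_comp.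
    exact: mf.
  exact: (@measurable_snd _ _ R R).
have bE (l : mR * (mR * mR) -> R) :
    (fun z => l z * k (sqn3 z))%R @^-1` S `&` ball3 = [set z | H (l z, sqn3 z)].
  by apply/seteqP; split => z; rewrite /ball3 /H /= in_itv.
rewrite (bE (lin3 a b d)) (bE (fun z => z.1)).
by rewrite (leb3_rotation mH abd).
Qed.

Lemma direction_slab (t : R) : (0 < t < 1)%R ->
  P ((fun z => z.1 * k (sqn3 z))%R @^-1` [set x | (`|x| < t)%R]) = t%:E.
Proof.
move=> t01; rewrite PE; last first.
  rewrite -[X in measurable X]setTI; apply: mU => //.
  rewrite (_ : [set x | _] = `](- t)%R, t[%classic) //.
  by apply/seteqP; split => x /=; rewrite in_itv/= ltr_norml.
rewrite (_ : _ `&` _ = [set z | (`|z.1 * k (sqn3 z)| < t)%R /\ (sqn3 z <= 1)%R]).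
  by rewrite slab_measure// -EFinM mulrCA mulVf ?mulr1// gt_eqF// ball_volume_gt0.
by apply/seteqP; split => z; rewrite /ball3 /= in_itv.
Qed.

End direction.
End sphere.

Section archimedes.
Context (disp : measure_display) (T : measurableType disp) (R : realType).
Variables (P : probability T R) (X : T -> R).
Hypothesis mX : measurable_fun [set: T] X.
Hypothesis slab : forall t, 0 < t < 1 -> P (X @^-1` [set x | `|x| < t]) = t%:E.
Hypothesis sym : forall S : set R, measurable S ->
  P (X @^-1` (-%R @^-1` S)) = P (X @^-1` S).

Let mpre (S : set R) : measurable S -> measurable (X @^-1` S).
Proof. by move=> mS; rewrite -[Y in measurable Y]setTI; exact: mX. Qed.

Let p (S : set R) : R := fine (P (X @^-1` S)).

Let pE (S : set R) : measurable S -> P (X @^-1` S) = (p S)%:E.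
Proof. by move=> mS; rewrite fineK// fin_num_measure//; exact: mpre. Qed.

Let p_le (S1 S2 : set R) : measurable S1 -> measurable S2 -> S1 `<=` S2 -> p S1 <= p S2.
Proof.
move=> m1 m2 s12; rewrite -lee_fin -!pE//.
by apply: le_measure; rewrite ?inE; [exact: mpre|exact: mpre|move=> t; exact: s12].
Qed.

Let p_itv (t : R) : 0 < t < 1 ->
  p `]-oo, - t]%classic = (1 - t) / 2 /\ p `]-oo, t[%classic = (1 + t) / 2.
Proof.
move=> t01; have /andP[t0 t1] := t01.
have hs : p `](- t), t[%classic = t.
  rewrite /p; have -> : X @^-1` `](- t), t[%classic = X @^-1` [set x | `|x| < t].
    by apply/seteqP; split => z; rewrite /= in_itv/= ltr_norml.
  by rewrite slab.
have hm : p `[t, +oo[%classic = p `]-oo, - t]%classic.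
  rewrite /p -sym//; congr (fine (P _)).
  by apply/seteqP; split => z; rewrite /= !in_itv/= andbT lerNr.
have h1 : p `]-oo, t[%classic = p `]-oo, - t]%classic + p `](- t), t[%classic.
  apply: EFin_inj; rewrite EFinD -!pE//.
  rewrite -measureU//; [|exact: mpre|exact: mpre|].
    congr (P _); apply/seteqP; split => z; rewrite /= !in_itv/=.
      by move=> h; case: (leP (X z) (- t)) => h'; [left|right].
    by move=> [h|/andP[]//]; apply: le_lt_trans h _; lra.
  apply/seteqP; split => z //=; rewrite !in_itv/= => -[h1 /andP[h2 _]].
  by move: (lt_le_trans h2 h1); rewrite ltxx.
have h2 : p `]-oo, t[%classic + p `[t, +oo[%classic = 1.
  apply: EFin_inj; rewrite EFinD -!pE//.
  rewrite -measureU//; [|exact: mpre|exact: mpre|].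
    rewrite -(probability_setT P); congr (P _).
    apply/seteqP; split => z; rewrite //= !in_itv/= andbT.
    by move=> _; case: (ltP (X z) t) => h; [left|right].
  apply/seteqP; split => z //=; rewrite !in_itv/= andbT => -[h1' h2].
  by move: (lt_le_trans h1' h2); rewrite ltxx.
by split; lra.
Qed.

(** A symmetric variable X with P(|X| < t) = t is uniform on [-1, 1], stated for
    its image (1 + X) / 2. *)
Lemma symmetric_slab_uniform : has_law P (fun t => 2^-1 + X t / 2) (uniform01 R).
Proof.
apply: has_law_rays => [|x].
  by apply: measurable_funD => //; apply: measurable_funM.
have -> : (fun t => 2^-1 + X t / 2) @^-1` `]-oo, x]%classic = X @^-1` `]-oo, 2 * x - 1]%classic.
  by apply/seteqP; split => z; rewrite /= !in_itv/= => h; lra.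
have up (u : R) : 2 * x - 1 < u -> 0 < u < 1 -> p `]-oo, 2 * x - 1]%classic <= (1 + u) / 2.
  move=> xu u01; rewrite -(p_itv u01).2; apply: p_le => // z.
  by rewrite /= !in_itv/= => h; apply: le_lt_trans xu.
have up' (u : R) : 2 * x - 1 <= - u -> 0 < u < 1 -> p `]-oo, 2 * x - 1]%classic <= (1 - u) / 2.
  move=> xu u01; rewrite -(p_itv u01).1; apply: p_le => // z.
  by rewrite /= !in_itv/= => h; apply: le_trans xu.
have lo (u : R) : - u <= 2 * x - 1 -> 0 < u < 1 -> (1 - u) / 2 <= p `]-oo, 2 * x - 1]%classic.
  move=> xu u01; rewrite -(p_itv u01).1; apply: p_le => // z.
  by rewrite /= !in_itv/= => h; apply: le_trans xu.
have lo' (u : R) : u <= 2 * x - 1 -> 0 < u < 1 -> (1 + u) / 2 <= p `]-oo, 2 * x - 1]%classic.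
  move=> xu u01; rewrite -(p_itv u01).2; apply: p_le => // z.
  by rewrite /= !in_itv/= => h; apply: ltW; apply: lt_le_trans xu.
have p0 : 0 <= p `]-oo, 2 * x - 1]%classic by rewrite -lee_fin -pE.
have p1 : p `]-oo, 2 * x - 1]%classic <= 1.
  by rewrite -lee_fin -pE// probability_le1//; exact: mpre.
rewrite pE// uniform01E//.
have [x0|x0] := ltP x 0.
  have -> : `]-oo, x]%classic `&` `[0, 1]%classic = set0 :> set R.
    by apply/seteqP; split => z //=; rewrite !in_itv/= => -[h /andP[h0 _]]; lra.
  rewrite measure0; congr EFin; apply/eqP; rewrite eq_le p0 andbT.
  apply/ler_addgt0Pr => e e0; rewrite add0r.
  have [e1|e1] := leP 1 e; first exact: le_trans e1.
  by apply: le_trans (up' (1 - e) _ _) _; [lra|apply/andP; split; lra|lra].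
have [x1|x1] := leP 1 x.
  have -> : `]-oo, x]%classic `&` `[0, 1]%classic = `[0, 1]%classic :> set R.
    apply/seteqP; split => z; rewrite /= !in_itv/=; [by case|move=> h].
    by split=> //; move: h => /andP[_ h]; exact: le_trans h x1.
  rewrite lebesgue_measure_itv/= lte_fin ltr01 oppr0 adde0; congr EFin.
  apply/eqP; rewrite eq_le p1/=; apply/ler_addgt0Pr => e e0.
  have [e1|e1] := leP 1 e; first by rewrite (le_trans e1)// lerDr.
  by have := lo' (1 - e) _ _; lra.
have -> : `]-oo, x]%classic `&` `[0, 1]%classic = `[0, x]%classic :> set R.
  apply/seteqP; split => z; rewrite /= !in_itv/=; [by move=> [-> /andP[->]]|move=> /andP[-> h]].
  by split=> //=; apply: ltW; exact: le_lt_trans h x1.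
rewrite lebesgue_measure_itv/= lte_fin.
have -> : (if 0 < x then (x%:E - 0%:E)%E else 0%E) = x%:E.
  case: ifPn; first by rewrite sube0.
  by rewrite -leNgt => h; congr EFin; lra.
congr EFin; apply/eqP; rewrite eq_le; apply/andP; split; apply/ler_addgt0Pr => e e0.
  have [xh|xh] := ltP x 2^-1.
    have [x00|x00] := ltP 0 x.
      by have := up' (1 - 2 * x) _ _; lra.
    have [e1|e1] := leP 1 e; first by lra.
    by have := up' (1 - e) _ _; lra.
  have [h|h] := ltP (2 * x - 1 + e) 1; last by lra.
  by have := up (2 * x - 1 + e) _ _; lra.
have [xh|xh] := ltP 2^-1 x; first by have := lo' (2 * x - 1) _ _; lra.
have [x00|x00] := ltP 0 x; last by lra.
have [xh'|xh'] := ltP x 2^-1; first by have := lo (1 - 2 * x) _ _; lra.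
have [e1|e1] := leP 1 e; first by lra.
by have := lo e _ _; lra.
Qed.

End archimedes.

(** A random point Z of the sphere of radius 1/2 centred at the origin, all of
    whose projections are uniform on an interval of length 1. *)
Lemma sphere_uniform (R : realType) :
  exists (disp : measure_display) (T : measurableType disp)
    (P : probability T R) (Z : 'I_3 -> T -> R),
    forall v : 'I_3 -> R, \sum_k v k ^+ 2 = 1 ->
      has_law P (fun t => 2^-1 + \sum_k v k * Z k t) (uniform01 R).
Proof.
pose mR := measurableTypeR R.
have [P PE] := uniform_ball R.
pose U (k : 'I_3) (z : mR * (mR * mR)) : R :=
  nth 0 [:: z.1; z.2.1; z.2.2] k * inv_norm (sqn3 z).
exists _, (mR * (mR * mR))%type, P, (fun k z => U k z / 2) => v v1.
pose a := v ord0; pose b := v (lift ord0 ord0); pose d := v (lift ord0 (lift ord0 ord0)).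
have abd : a ^+ 2 + b ^+ 2 + d ^+ 2 = 1.
  by rewrite -v1 !big_ord_recl big_ord0 addr0 addrA.
rewrite (_ : (fun t => _) = fun z => 2^-1 + lin3 a b d z * inv_norm (sqn3 z) / 2).
  apply: symmetric_slab_uniform.
  - apply: measurable_funM; first exact: measurable_lin3.
    by apply: measurableT_comp; [exact: measurable_powR|exact: measurable_sqn3].
  - move=> t t01; rewrite (direction_rotation PE)//; first exact: direction_slab.
    rewrite (_ : [set x | _] = `](- t), t[%classic) //.
    by apply/seteqP; split => x /=; rewrite in_itv/= ltr_norml.
  - move=> S mS; rewrite [RHS](direction_rotation PE)//.
    transitivity (P ((fun z => lin3 (- a) (- b) (- d) z * inv_norm (sqn3 z)) @^-1` S)).
      have linN z : lin3 (- a) (- b) (- d) z = - lin3 a b d z by rewrite /lin3; ring.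
      by congr (P _); apply/seteqP; split => z; rewrite /= linN mulNr.
    by rewrite (direction_rotation PE)// !sqrrN.
apply/funext => z.
by rewrite !big_ord_recl big_ord0 addr0 /U /= /lin3 -/a -/b -/d; field.
Qed.

(** * The four sets of matrices *)

Theorem proposition5 (R : realType) (d : nat) :
  [/\ ((d <= 9)%N ->
         correlation_matrices_of (uniform01 R) d = correlation_matrices R d) /\
      ((10 <= d)%N ->
         correlation_matrices_of (uniform01 R) d `<=` correlation_matrices R d),
      spearman_matrices R d = correlation_matrices_of (uniform01 R) d,
      blomqvist_matrices R d = correlation_matrices_of (bernoulli_half R) d &
      van_der_waerden_matrices R d = correlation_matrices R d].
Proof.
have subU : correlation_matrices_of (uniform01 R) d `<=` correlation_matrices R d.
  exact: correlation_matrices_of_sub (@uniform01_nondegenerate R).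
split.
- split=> [d9|_] //; apply/seteqP; split=> // A [As Ap _ A1].
  have [disp [T [P [Z lZ]]]] := sphere_uniform R.
  apply: (gram_rank3_convex d9) A1 => //.
  + by move=> V; apply: (gram_correlation_matrix (@uniform01_nondegenerate R) lZ).
  + by move=> B C t t01; apply: (correlation_matrices_of_convex (@uniform01_nondegenerate R)).
- apply/seteqP; split=> [A [disp [T [P [X [cX ->]]]]]|A].
    exact: (kappa_matrix_law (uniform01 R) cX).
  exact: correlation_matrix_kappa (@uniform01_nondegenerate R) (@uniform01_continuous R).
- apply/seteqP; split=> [A [disp [T [P [X [cX ->]]]]]|A].
    exact: (kappa_matrix_law (bernoulli_half R) cX).
  exact: correlation_matrix_blomqvist.
- apply/seteqP; split=> [A [disp [T [P [X [cX ->]]]]]|A [As Ap _ A1]].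
    apply: (correlation_matrices_of_sub (@std_normal_nondegenerate R)).
    exact: (kappa_matrix_law (std_normal R) cX).
  have [V AV] := psd_gram_factor (conj As Ap).
  have [disp [T [P [Z lZ]]]] := gaussian_vector R d.
  apply: (correlation_matrix_kappa (@std_normal_nondegenerate R) (@std_normal_continuous R)).
  rewrite AV; rewrite AV in A1.
  apply: (gram_correlation_matrix (P := P) (m := 0) (Z := Z) (@std_normal_nondegenerate R) _ A1).
  move=> v v1; rewrite (_ : (fun t => _) = (fun t => \sum_k v k * Z k t)).
    exact: lZ.
  by apply/funext => t; rewrite add0r.
Qed.
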